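(* Let $E$ be a cm-convenient real locally convex Hausdorff space, and let $f:E\supseteq\operatorname{dom}f\to E$ be a map of class $C^\infty_c$ which is Colombeau$_0$-tame at $x_0$. Then there is a set $U$, open in the locally convex topology of $E$, with $x_0\in U$, such that the restriction $f|_U$ of $f$ to $U\cap\operatorname{dom}f$ is injective and its inverse $(f|_U)^{-1}:E\supseteq f(U\cap\operatorname{dom}f)\to E$ is of class $C^\infty_c$.
   Context: All spaces are real locally convex Hausdorff topological vector spaces; ''bounded'' means von Neumann bounded. Such a space $E$ is locally complete (Mackey complete) if for every closed absolutely convex bounded set $B\subseteq E$, the linear span of $B$, normed by the Minkowski functional of $B$, is a Banach space. Mackey closure topology: a set $U\subseteq E$ is mopen in $E$ if for every $x\in U$ and every bounded $B\subseteq E$ there is a real $\delta>0$ with $tB\subseteq U-x$ for all $0\le t\le\delta$. The mopen sets form a topology $\tau_{\mathrm{Mac}}E$ on $E$, which contains the locally convex topology of $E$. cm-convenient: $E$ is called cm-convenient if it is bornological and locally complete and, for every $k\in\{0,1,2,\dots\}$, the Mackey closure topology $\tau_{\mathrm{Mac}}(E^k)$ of the product space $E^k$ coincides with the product locally convex topology of $E^k$. Class $C^{\infty}_c$ (Keller): a map $f:E\supseteq\operatorname{dom}f\to F$ is of class $C^\infty_c$ if $\operatorname{dom}f$ is open in the locally convex topology of $E$ and for every $l\in\{0,1,2,\dots\}$ the order $l$ variation $(x,v_1,\dots,v_l)\mapsto d^lf(x;v_1,\dots,v_l)$ (iterated directional derivatives of $f$ at $x$ in directions $v_1,\dots,v_l$,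 with $d^0f=f$) is defined for all $x\in\operatorname{dom}f$ and all $v_1,\dots,v_l\in E$, and is continuous as a map from $\operatorname{dom}f\times E^l\subseteq E^{l+1}$ (product of the locally convex topologies) to $F$. Bornological generator: a set $\mathcal{B}$ of nonempty bounded, closed, absolutely convex subsets of $E$ is a bornological generator for $E$ if for all $A,B\in\mathcal{B}$ there is $C\in\mathcal{B}$ with $A\cup B\subseteq C$, and for every bounded $A\subseteq E$ there are a real $t>0$ and $B\in\mathcal{B}$ with $A\subseteq tB$. For $B\in\mathcal{B}$, let $E_B=\{tv:t>0,\ v\in B\}$ be the linear span of $B$. Gateaux differentiable: $f:E\supseteq\operatorname{dom}f\to E$ is Gateaux differentiable if for every $x\in\operatorname{dom}f$ and $v\in E$ one has $x+tv\in\operatorname{dom}f$ for all sufficiently small real $t$, the limit $f'(x)v=\lim_{t\to0}t^{-1}(f(x+tv)-f(x))$ exists in $E$, and $f'(x):E\to E$ is a continuous linear map. $\mathrm{Colo}_A(f,y_0,\varepsilon,\mathcal{B})$ means: $E$ is bornological and locally complete, $f:E\supseteq\operatorname{dom}f\to E$ is Gateaux differentiable, $\varepsilon$ is a positive real number, $\mathcal{B}$ is a bornological generator for $E$, and for every $B\in\mathcal{B}$ and every $v\in B$, putting $y_1=y_0+2v$, one has $y_1\in\operatorname{dom}f$, $y_1\in E_B$, and $(f'(y_1)-f'(y_0))(B)\subseteq\varepsilon\, f'(y_0)(B)$. $\mathrm{Colo}_0(f,y_0,\varepsilon,\mathcal{B})$ means: $\mathrm{Colo}_A(f,y_0,\varepsilon,\mathcal{B})$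 holds and $f'(y_0):E\to E$ is a linear homeomorphism. Colombeau$_0$-tame: $f$ is Colombeau$_0$-tame at $y_0\in E$ if for every $V$ open in the locally convex topology of $E$ with $y_0\in V$ there is some $\mathcal{B}$ such that $\mathrm{Colo}_0(f|_V,y_0,\frac12,\mathcal{B})$ holds, where $f|_V$ is the restriction of $f$ to $V\cap\operatorname{dom}f$. *)

(* Defs.v *)
From HB Require Import structures.
From mathcomp Require Import all_boot all_order all_algebra.
From mathcomp Require Import all_classical all_reals all_analysis.
Import Order.TTheory GRing.Theory Num.Theory.
Import numFieldNormedType.Exports.

Set Implicit Arguments.
Unset Strict Implicit.
Unset Printing Implicit Defensive.

Local Open Scope classical_set_scope.
Local Open Scope ring_scope.

(* E^n: functions 'I_n -> E with the pointwise vector space structure and the *)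
(* product topology (the library has no such instance on 'rV[E]_n). *)
Definition power (E : Type) (n : nat) : Type := 'I_n -> E.

Section power_topology.
Context (E : topologicalType) (n : nat).

HB.instance Definition _ :=
  Topological.copy (power E n) (prod_topology (fun _ : 'I_n => E)).

Lemma power_cvgP (T : Type) (G : set_system T) {FG : Filter G}
    (f : T -> power E n) (p : power E n) :
  (forall i, (fun t => f t i) @ G --> p i) -> f @ G --> p.
Proof.
move=> h.
apply/(@cvg_sup _ _ _ (f @ G) p (fmap_filter f FG)) => i.
move=> U /= [V [[W oW <-]] Wp WU].
have : nbhs (p i) W by apply: open_nbhs_nbhs; split.
by move=> /(h i) /=; rewrite /nbhs/=; apply: filterS => t Wt; apply: WU.
Qed.

Lemma power_proj_continuous i : continuous (fun p : power E n => p i).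
Proof. exact: (@proj_continuous 'I_n (fun=> E) i). Qed.

End power_topology.

Section power_tvs.
Context (R : numFieldType) (E : tvsType R) (n : nat).

HB.instance Definition _ :=
  Uniform.copy (power E n) (prod_topology (fun _ : 'I_n => E)).
HB.instance Definition _ := GRing.Lmodule.copy (power E n) ('I_n -> E).

Let power_add_continuous :
  continuous (fun x : power E n * power E n => x.1 + x.2).
Proof.
move=> [x y]; apply: power_cvgP => i.
apply: (@continuous2_cvg _ E E E (nbhs (x, y)) _
  (fun z => z.1 i) (fun z => z.2 i) +%R (x i) (y i)).
- exact: (@add_continuous E (x i, y i)).
- apply: (@continuous_comp _ _ _ fst (fun p : power E n => p i) (x, y)).
    exact: cvg_fst.
  exact: power_proj_continuous.
- apply: (@continuous_comp _ _ _ snd (fun p : power E n => p i) (x, y)).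
    exact: cvg_snd.
  exact: power_proj_continuous.
Qed.

Let power_scale_continuous :
  continuous (fun z : R^o * power E n => z.1 *: z.2).
Proof.
move=> [k x]; apply: power_cvgP => i.
apply: (@continuous2_cvg _ R^o E E (nbhs (k, x)) _
  (fun z => z.1) (fun z => z.2 i) *:%R k (x i)).
- exact: (@scale_continuous R E (k, x i)).
- exact: cvg_fst.
- apply: (@continuous_comp _ _ _ snd (fun p : power E n => p i) (k, x)).
    exact: cvg_snd.
  exact: power_proj_continuous.
Qed.

Let power_locally_convex :
  exists2 B : set_system (power E n),
    (forall b, b \in B -> convex_set b) & basis B.
Proof.
exists [set U | open U /\ convex_set U].
  by move=> b /set_mem [].
split; first by move=> b [].
move=> x U Ux.
have [B Bc [Bo Bb]] := @locally_convex R E.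
have [P PU [oP Px]] : exists2 P : 'I_n -> set E,
    (forall p : power E n, (forall i, P i (p i)) -> U p) &
    (forall i, B (P i)) /\ (forall i, P i (x i)).
  suff [P Px PU] : exists2 P : 'I_n -> set E, (forall i, nbhs (x i) (P i)) &
      (forall p : power E n, (forall i, P i (p i)) -> U p).
    have /choice [Q HQ] : forall i, exists Q, B Q /\ Q (x i) /\ Q `<=` P i.
      by move=> i; have [Q [BQ Qx] QP] := Bb _ _ (Px i); exists Q.
    exists Q; last by split=> i; have [? []] := HQ i.
    by move=> p Qp; apply: PU => i; have [_ [_]] := HQ i; apply; exact: Qp.
  pose G := filter_from [set P : 'I_n -> set E | forall i, nbhs (x i) (P i)]
    (fun P => [set p : power E n | forall i, P i (p i)]).
  have FG : Filter G.
    apply: filter_from_filter.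
      by exists (fun=> setT) => i; exact: filterT.
    move=> P Q xP xQ; exists (fun i => P i `&` Q i).
      by move=> i; apply: filterI; [exact: xP|exact: xQ].
    by move=> p PQ; split=> i; have [] := PQ i.
  have Gx : id @ G --> x.
    apply: power_cvgP => i W xW /=; exists (dfwith (fun=> setT) i W).
      by move=> j; case: dfwithP => // *; exact: filterT.
    by move=> p /= /(_ i); rewrite dfwithin.
  by have [P xP PU] := Gx _ Ux; exists P.
exists [set p | forall i, P i (p i)]; last by move=> p /PU.
split=> //; split.
  rewrite openE => p Pp.
  apply: (@filter_forall _ 'I_n (fun i q => P i (q i)) (nbhs p)) => i.
  apply: (@power_proj_continuous E n i p).
  by apply: open_nbhs_nbhs; split; [exact: Bo|exact: Pp].
move=> p q l /set_mem Pp /set_mem Pq; apply/mem_set => i.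
by apply/set_mem/(Bc (P i)); [exact/mem_set|exact/mem_set|exact/mem_set].
Qed.

HB.instance Definition _ := PreTopologicalNmodule_isTopologicalNmodule.Build
  (power E n) power_add_continuous.
HB.instance Definition _ := TopologicalNmodule_isTopologicalLmodule.Build
  R (power E n) power_scale_continuous.
HB.instance Definition _ := Uniform_isTvs.Build R (power E n)
  power_locally_convex.

End power_tvs.

(* A tvsType is locally convex by definition; being Hausdorff is assumed *)
(* separately, as hausdorff_space E. *)
Section locally_convex_spaces.
Context (R : realType).
Implicit Type E : tvsType R.

Definition dilate E (t : R) (B : set E) : set E := [set t *: b | b in B].

Definition absorbs E (A B : set E) : Prop :=
  exists2 r : R, 0 < r & forall s : R, r <= `|s| -> B `<=` dilate s A.

Definition vN_bounded E (B : set E) : Prop :=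
  forall U : set E, nbhs 0 U -> absorbs U B.

Definition absolutely_convex E (B : set E) : Prop :=
  forall (x y : E) (a b : R), B x -> B y -> `|a| + `|b| <= 1 ->
    B (a *: x + b *: y).

Definition bornological E : Prop :=
  forall A : set E, absolutely_convex A ->
    (forall B : set E, vN_bounded B -> absorbs A B) -> nbhs 0 A.

Definition linear_span E (B : set E) : set E :=
  [set x | exists (n : nat) (c : 'I_n -> R) (b : 'I_n -> E),
    (forall i, B (b i)) /\ x = \sum_(i < n) c i *: b i].

Definition minkowski E (B : set E) (x : E) : R :=
  inf [set t : R | 0 < t /\ dilate t B x].

Definition banach_norm E (V : set E) (p : E -> R) : Prop :=
  [/\ forall x, V x -> 0 <= p x,
      forall x, V x -> p x = 0 -> x = 0,
      forall (a : R) x, V x -> p (a *: x) = `|a| * p x,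
      forall x y, V x -> V y -> p (x + y) <= p x + p y &
      forall u : nat -> E, (forall n, V (u n)) ->
        (forall e : R, 0 < e -> exists N : nat, forall m n : nat,
          (N <= m)%N -> (N <= n)%N -> p (u m - u n) < e) ->
        exists2 l : E, V l &
          (p (u n - l) @[n --> \oo] --> (0 : R))].

Definition locally_complete E : Prop :=
  forall B : set E, closed B -> absolutely_convex B -> vN_bounded B ->
    banach_norm (linear_span B) (minkowski B).

Definition mopen E (U : set E) : Prop :=
  forall x : E, U x -> forall B : set E, vN_bounded B ->
    exists2 delta : R, 0 < delta &
      forall t : R, 0 <= t <= delta ->
        dilate t B `<=` [set u - x | u in U].

Definition cm_convenient E : Prop :=
  [/\ bornological E, locally_complete E &
      forall (k : nat) (U : set (power E k)), mopen U <-> open U].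

Definition bornological_generator E (BB : set (set E)) : Prop :=
  [/\ forall B, BB B ->
        [/\ B !=set0, vN_bounded B, closed B & absolutely_convex B],
      forall A B, BB A -> BB B -> exists2 C, BB C & A `|` B `<=` C &
      forall A : set E, vN_bounded A ->
        exists2 t : R, 0 < t & exists2 B, BB B & A `<=` dilate t B].

(* The linear span of B, for B nonempty and absolutely convex. *)
Definition disk_span E (B : set E) : set E :=
  [set x | exists2 t : R, 0 < t & dilate t B x].

End locally_convex_spaces.

(* A map T >= dom f -> U. The values of pval outside dom are irrelevant: every *)
(* notion below only depends on the restriction of pval to dom. *)
Record partial_map (T U : Type) := PartialMap {
  dom : set T;
  pval :> T -> U
}.

Definition prestrict (T U : Type) (f : partial_map T U) (V : set T) :
  partial_map T U := PartialMap (V `&` dom f) f.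

Definition pinjective (T U : Type) (f : partial_map T U) : Prop :=
  set_inj (dom f) f.

(* Meaningful when f is injective on its domain. *)
Definition pinverse (R : numDomainType) (E : lmodType R) (U : choiceType)
    (f : partial_map E U) : partial_map U E :=
  PartialMap (f @` dom f) ('pinv_(fun=> 0) (dom f) f).

Section differentiability.
Context (R : realType).
Implicit Types E F : tvsType R.

(* The library's derivative 'D_v f is only available on normed modules. *)
Definition has_dderiv E F (f : E -> F) (x v : E) (w : F) : Prop :=
  t^-1 *: (f (x + t *: v) - f x) @[t --> (0 : R)^'] --> w.

Definition dderiv E F (f : E -> F) (x v : E) : F :=
  xget 0 [set w | has_dderiv f x v w].

(* d^(l+1) f (x; v_1, .., v_(l+1)) is the derivative at x, in the direction *)
(* v_(l+1), of y |-> d^l f (y; v_1, .., v_l). *)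
Fixpoint variation E F (f : E -> F) (l : nat) (x : E) : power E l -> F :=
  match l with
  | 0 => fun=> f x
  | l'.+1 => fun v =>
      let v' : power E l' := fun i => v (widen_ord (leqnSn l') i) in
      dderiv (fun y => variation f y v') x (v ord_max)
  end.

Fixpoint variation_defined E F (f : partial_map E F) (l : nat) (x : E) :
    power E l -> Prop :=
  match l with
  | 0 => fun=> dom f x
  | l'.+1 => fun v =>
      let v' : power E l' := fun i => v (widen_ord (leqnSn l') i) in
      (\forall t \near (0 : R), variation_defined f (x + t *: v ord_max) v') /\
      exists w, has_dderiv (fun y => variation f y v') x (v ord_max) w
  end.

Definition Cinfty_c E F (f : partial_map E F) : Prop :=
  open (dom f) /\
  forall l : nat,
    (forall (x : E) (v : power E l), dom f x -> variation_defined f x v) /\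
    {within [set p : E * power E l | dom f p.1],
      continuous (fun p => variation f p.1 p.2)}.

Definition gateaux_differentiable E (f : partial_map E E) : Prop :=
  forall x, dom f x ->
    [/\ forall v : E, (\forall t \near (0 : R), dom f (x + t *: v)) /\
          exists w, has_dderiv f x v w,
        linear (dderiv f x) &
        continuous (dderiv f x)].

Definition linear_homeomorphism E (L : E -> E) : Prop :=
  [/\ linear L, continuous L &
      exists M : E -> E, [/\ cancel L M, cancel M L & continuous M]].

Definition Colo_A E (f : partial_map E E) (y0 : E) (eps : R)
    (BB : set (set E)) : Prop :=
  [/\ bornological E /\ locally_complete E,
      gateaux_differentiable f,
      0 < eps,
      bornological_generator BB &
      forall B v, BB B -> B v ->
        let y1 := y0 + 2 *: v in
        [/\ dom f y1, disk_span B y1 &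
            [set dderiv f y1 b - dderiv f y0 b | b in B]
              `<=` dilate eps (dderiv f y0 @` B)]].

Definition Colo_0 E (f : partial_map E E) (y0 : E) (eps : R)
    (BB : set (set E)) : Prop :=
  Colo_A f y0 eps BB /\ linear_homeomorphism (dderiv f y0).

Definition colombeau0_tame E (f : partial_map E E) (y0 : E) : Prop :=
  forall V : set E, open V -> V y0 ->
    exists BB : set (set E), Colo_0 (prestrict f V) y0 2^-1 BB.

End differentiability.

(* Main.v *)
Require Import Defs.
From mathcomp Require Import all_boot all_order all_algebra.
From mathcomp Require Import all_classical all_reals all_analysis.
From mathcomp Require Import ring lra.
Import Order.TTheory GRing.Theory Num.Theory.
Import numFieldNormedType.Exports Defs.

(** Let [L] be the derivative [f' x0] and [M] its inverse. Tameness says that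
    for a disk [B] of the generator and [x] in [x0 + 2 B] the linear map
    [M \o f' x] differs from the identity by a map of [B] into [B / 2]. In the
    gauge of [B] the map [M \o f] is therefore, on [x0 + 2 B], a perturbation
    of the identity by a contraction of ratio [1/2] ([map_near_identity], by
    the mean value theorem). The span of [B] is a Banach space, so [M \o f] is
    injective on [x0 + 2 B], its values cover [M (f x0) + B], and its inverse
    at most doubles gauges. The disks are directed by inclusion, so these
    inverses agree and define one map [G] on the union of the sets
    [f x0 + r L B] with [r < 1]. That union is mopen, hence open: here
    cm-convenience of [E] itself is used.

    The gauge estimates give continuity only for the Mackey closure topology,
    and only for [G] and for [(z, v) |-> f' (G z)^-1 v]. Cm-convenience for [E]
    and for [E^2] turns this into continuity ([G_continuous],
    [dderiv_inv_cvg]). For the second map, bornologicity makes the inverses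
    [f' x ^-1], [x] in [x0 + 2 B], equicontinuous ([dderiv_inv_equicontinuous]):
    they are uniformly bounded on bounded sets. The difference quotients of
    [G] stay in a bounded set, and [f] is differentiable uniformly over bounded
    sets of directions because of its second variation ([uniform_dderiv]); so
    the derivative of [G] at [z] is [f' (G z)^-1].

    For the higher orders, consider the expressions formed from [G], directions,
    [f' (G z)^-1] and the variations of [f] at [G z]. Differentiating such an
    expression in [z] gives another one, by the chain rule for variations, and
    each one is continuous. All variations of [G] are of this form, so [G] is of
    class [C^oo_c] ([inverse_Cinfty_c]). The chain rule rests on
    [strict_dderiv]: a continuous directional derivative is the limit of
    difference quotients whose base point and direction both move. *)

Set Implicit Arguments.
Unset Strict Implicit.
Unset Printing Implicit Defensive.
Local Open Scope classical_set_scope.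
Local Open Scope ring_scope.

(** * Locally convex spaces and their disk neighbourhoods *)

Section linear_maps.
Context (R : realType) (V W : lmodType R) (h : V -> W).
Hypothesis lin_h : linear h.

Lemma linear_at0 : h 0 = 0.
Proof. by have := lin_h (-1) 0 0; rewrite scaleN1r addr0 oppr0 scaleN1r addNr. Qed.

Lemma linear_at_scale a x : h (a *: x) = a *: h x.
Proof. by have := lin_h a x 0; rewrite linear_at0 !addr0. Qed.

Lemma linear_at_sub x y : h (x - y) = h x - h y.
Proof. by have := lin_h (-1) y x; rewrite !scaleN1r !(addrC (- _)). Qed.

Lemma linear_at_add x y : h (x + y) = h x + h y.
Proof. by have := lin_h 1 x y; rewrite !scale1r. Qed.

End linear_maps.

Section tvs_limits.
Context (R : realType) (E : tvsType R) (T : Type) (F : set_system T).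
Context {FF : Filter F}.

Lemma tvs_cvgD (f g : T -> E) (a b : E) :
  f @ F --> a -> g @ F --> b -> (fun x => f x + g x) @ F --> a + b.
Proof.
move=> fa gb; apply: (@continuous2_cvg _ E E E F _ f g +%R a b) => //.
exact: (@add_continuous E (a, b)).
Qed.

Lemma tvs_cvgZ (k : T -> R) (f : T -> E) (l : R) (a : E) :
  k @ F --> l -> f @ F --> a -> (fun x => k x *: f x) @ F --> l *: a.
Proof.
move=> kl fa; apply: (@continuous2_cvg _ R^o E E F _ k f *:%R l a) => //.
exact: (@scale_continuous R E (l, a)).
Qed.

Lemma tvs_cvgN (f : T -> E) (a : E) :
  f @ F --> a -> (fun x => - f x) @ F --> - a.
Proof.
move=> fa; apply: (@cvg_comp _ _ _ f -%R F (nbhs a) _ fa).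
exact: opp_continuous.
Qed.

Lemma tvs_cvgB (f g : T -> E) (a b : E) :
  f @ F --> a -> g @ F --> b -> (fun x => f x - g x) @ F --> a - b.
Proof. by move=> fa gb; apply: tvs_cvgD => //; exact: tvs_cvgN. Qed.

Lemma tvs_cvg_sum (I : Type) (r : seq I) (f : I -> T -> E) (a : I -> E) :
  (forall i, f i @ F --> a i) ->
  (fun x => \sum_(i <- r) f i x) @ F --> \sum_(i <- r) a i.
Proof.
move=> fa; elim: r => [|i r IH].
  rewrite big_nil; under eq_fun do rewrite big_nil.
  exact: cvg_cst.
rewrite big_cons; under eq_fun do rewrite big_cons.
exact: tvs_cvgD.
Qed.

Lemma tvs_cvgP (f : T -> E) (a : E) :
  f @ F --> a <-> forall V, nbhs (0 : E) V -> \forall x \near F, V (f x - a).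
Proof.
split=> [fa V V0|H].
  have : (fun x => f x - a) @ F --> (0 : E).
    by rewrite -(subrr a); apply: tvs_cvgB => //; exact: cvg_cst.
  exact.
rewrite -[a]add0r.
have : (fun x => (f x - a) + a) @ F --> 0 + a.
  by apply: tvs_cvgD; [exact: H|exact: cvg_cst].
by under eq_fun do rewrite subrK.
Qed.

End tvs_limits.

Section disk_neighbourhoods.
Context (R : realType) (E : tvsType R).
Implicit Types (A B V W : set E) (x y : E).

Lemma abs_convex_opp V x : absolutely_convex V -> V x -> V (- x).
Proof.
move=> cV Vx; have := cV x x (-1) 0 Vx Vx.
by rewrite scale0r addr0 scaleN1r normrN1 normr0 addr0; apply.
Qed.

Lemma abs_convex_scale V (a : R) x :
  absolutely_convex V -> `|a| <= 1 -> V x -> V (a *: x).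
Proof.
move=> cV a1 Vx; have := cV x x a 0 Vx Vx.
by rewrite scale0r addr0 normr0 addr0; apply.
Qed.

Lemma abs_convex_zero V : absolutely_convex V -> V !=set0 -> V 0.
Proof.
by move=> cV [x Vx]; rewrite -(scale0r x); apply: abs_convex_scale => //; rewrite normr0.
Qed.

Lemma abs_convex_conv V (a b : R) x y : absolutely_convex V ->
  0 <= a -> 0 <= b -> a + b <= 1 -> V x -> V y -> V (a *: x + b *: y).
Proof. by move=> cV a0 b0 ab Vx Vy; apply: cV => //; rewrite !ger0_norm. Qed.

Lemma nbhs0_half V : nbhs (0 : E) V ->
  exists2 W, nbhs (0 : E) W & forall x y, W x -> W y -> V (x + y).
Proof.
move=> V0; have := @add_continuous E (0, 0) V; rewrite /= addr0 => /(_ V0).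
move=> [[W1 W2] /= [W10 W20] WV]; exists (W1 `&` W2); first exact: filterI.
by move=> x y [x1 _] [_ y2]; exact: (WV (x, y)).
Qed.

Lemma nbhs0_scale V (a : R) : nbhs (0 : E) V -> nbhs (0 : E) [set x | V (a *: x)].
Proof.
move=> V0; have : (fun x : E => a *: x) @ (0 : E) --> a *: (0 : E).
  by apply: tvs_cvgZ; [exact: cvg_cst|exact: cvg_id].
by rewrite scaler0; apply.
Qed.

Lemma nbhs0_translate V x : nbhs (0 : E) V <-> nbhs x [set y | V (y - x)].
Proof.
split=> V0.
  have : (fun y : E => y - x) @ x --> x - x.
    by apply: tvs_cvgB; [exact: cvg_id|exact: cvg_cst].
  by rewrite subrr; apply.
have : (fun y : E => y + x) @ (0 : E) --> 0 + x.
  by apply: tvs_cvgD; [exact: cvg_id|exact: cvg_cst].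
rewrite add0r => cv; have h : nbhs (0 : E) [set y | V (y + x - x)] := cv _ V0.
by apply: filterS h => y /=; rewrite addrK.
Qed.

(** The topology is given by seminorms: the closure of a symmetric convex
    neighbourhood [V] lies in [V + V], so closed disks form a basis at [0]. *)
Lemma nbhs0_disk U : nbhs (0 : E) U ->
  exists V, [/\ nbhs (0 : E) V, closed V, absolutely_convex V & V `<=` U].
Proof.
move=> U0.
have [W W0 WU] := nbhs0_half U0.
have [B Bc [Bo Bb]] := @locally_convex R E.
have [C [BC C0] CW] := Bb _ _ W0.
have cC : convex_set C by apply: Bc; apply/mem_set.
have C0n : nbhs (0 : E) C by apply: open_nbhs_nbhs; split => //; exact: Bo.
pose D := C `&` [set x | C (- x)].
have D0 : nbhs (0 : E) D.
  apply: filterI => //.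
  by have := nbhs0_scale (-1) C0n; apply: filterS => x /=; rewrite scaleN1r.
have cconv (a : R) x y : 0 <= a <= 1 -> C x -> C y -> C (a *: x + (1 - a) *: y).
  move=> a01 Cx Cy.
  have [a0 a1] := andP a01.
  have := cC x y (Itv01 a0 a1) (mem_set Cx) (mem_set Cy).
  by move=> /set_mem.
have cD : absolutely_convex D.
  have Dsgn (a : R) x : D x -> exists2 x', D x' & a *: x = `|a| *: x'.
    move=> Dx; have [a0|a0] := leP 0 a.
      by exists x => //; rewrite ger0_norm.
    rewrite ltr0_norm//; exists (- x); first by case: Dx => ? ?; split=> //=; rewrite opprK.
    by rewrite scalerN scaleNr opprK.
  have key (a b : R) x y : 0 <= a -> 0 <= b -> a + b <= 1 -> C x -> C y ->
      C (a *: x + b *: y).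
    move=> a0 b0 ab Cx Cy.
    have [e|ne] := eqVneq (a + b) 0.
      have -> : a = 0 by lra.
      have -> : b = 0 by lra.
      by rewrite !scale0r addr0.
    have s0 : 0 < a + b by rewrite lt_neqAle eq_sym ne addr_ge0.
    have h : C ((a / (a + b)) *: x + (1 - a / (a + b)) *: y).
      apply: cconv => //; rewrite divr_ge0 ?addr_ge0//=.
      by rewrite ler_pdivrMr// mul1r lerDl.
    have := @cconv (a + b) _ 0 _ h C0; rewrite scaler0 addr0 scalerDr !scalerA.
    have -> : (a + b) * (a / (a + b)) = a by field.
    have -> : (a + b) * (1 - a / (a + b)) = b by field.
    by apply; rewrite addr_ge0.
  move=> x y a b Dx Dy ab.
  have [x' [x1 x2] ->] := Dsgn a x Dx; have [y' [y1 y2] ->] := Dsgn b y Dy.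
  split=> /=; first exact: key.
  by rewrite opprD -!scalerN; apply: key.
exists (closure D); split.
- by apply: filterS D0; exact: subset_closure.
- exact: closed_closure.
- move=> x y a b clx cly ab.
  have : (fun z : E * E => a *: z.1 + b *: z.2) @ (x, y) --> a *: x + b *: y.
    by apply: tvs_cvgD; apply: tvs_cvgZ; [exact: cvg_cst|exact: cvg_fst|exact: cvg_cst|exact: cvg_snd].
  move=> cv N /cv [[N1 N2] /= [xN yN] NN].
  have [x' [Dx' Nx']] := clx _ xN; have [y' [Dy' Ny']] := cly _ yN.
  exists (a *: x' + b *: y'); split; first exact: cD.
  exact: (NN (x', y')).
- move=> x clx.
  have [y [Dy /= Dxy]] := clx _ ((nbhs0_translate D x).1 D0).
  rewrite -[x](subrK y); apply: WU; last by apply: CW; exact: Dy.1.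
  by apply: CW; case: Dxy => _ /=; rewrite opprB.
Qed.

End disk_neighbourhoods.

(** * The mean value theorem *)

Section mean_value.
Context (R : realType) (E : tvsType R).

(** The supremum of the points that [P] reaches is reached from the left, and
    is [b] since otherwise [P] would go on to its right. *)
Lemma real_induction (a b : R) (P : R -> Prop) : a <= b -> P a ->
  (forall s, a <= s <= b -> exists2 d : R, 0 < d &
    forall r, a <= r <= s -> s - d < r -> P r -> P s) ->
  (forall s, a <= s < b -> P s -> exists2 s', s < s' <= b & P s') ->
  P b.
Proof.
move=> ab Pa hl hr.
pose S := [set s | a <= s <= b /\ P s].
have supS : has_sup S.
  by split; [exists a; split=> //; rewrite lexx|exists b => s [/andP[]]].
have Sa : S a by split=> //; rewrite lexx.
pose s := sup S.
have as_ : a <= s by apply: ub_le_sup => //; case: supS.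
have sb : s <= b by apply: ge_sup; [exists a|move=> r [/andP[]]].
have Ps : P s.
  have [d d0 Hd] := hl s (introT andP (conj as_ sb)).
  have [r Sr dr] := sup_adherent d0 supS.
  apply: (Hd r) => //; last by case: Sr.
  apply/andP; split; first by case: Sr => /andP[].
  by apply: ub_le_sup => //; case: supS.
move: sb; rewrite le_eqVlt => /orP[/eqP <-//|sb].
have [s' /andP[ss' s'b] Ps'] := hr s (introT andP (conj as_ sb)) Ps.
have : s' <= s.
  apply: ub_le_sup; first by case: supS.
  by split=> //; rewrite s'b (le_trans as_ (ltW ss')).
by rewrite leNgt ss'.
Qed.

Lemma near0_ball (P : R -> Prop) :
  (\forall r \near (0 : R), P r) <->
  exists2 d : R, 0 < d & forall r, `|r| < d -> P r.
Proof.
split=> [/nbhs_ballP [d /= d0 dP]|[d d0 dP]].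
  by exists d => // r rd; apply: dP; rewrite -ball_normE /= sub0r normrN.
apply/nbhs_ballP; exists d => //= r; rewrite -ball_normE /= sub0r normrN.
exact: dP.
Qed.

Lemma dnear0_ball (P : R -> Prop) :
  (\forall r \near (0 : R)^', P r) <->
  exists2 d : R, 0 < d & forall r, r != 0 -> `|r| < d -> P r.
Proof.
split=> [/near0_ball [d d0 dP]|[d d0 dP]].
  by exists d => // r r0 rd; apply: dP.
by apply/near0_ball; exists d => // r rd r0; exact: dP.
Qed.

(** [x] is a multiple by [a] of an element of [V + W]; kept as a relation, so
    that no division occurs at [a = 0]. *)
Let joinable (V W : set E) (x : E) (a : R) :=
  exists v w, [/\ V v, W w & x = a *: (v + w)].

Let joinable_add V W x y (a b : R) :
  absolutely_convex V -> absolutely_convex W -> 0 <= a -> 0 <= b ->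
  joinable V W x a -> joinable V W y b -> joinable V W (x + y) (a + b).
Proof.
move=> cV cW a0 b0 [v [w [Vv Ww ->]]] [v' [w' [Vv' Ww' ->]]].
have [e|ne] := eqVneq (a + b) 0.
  have -> : a = 0 by lra.
  have -> : b = 0 by lra.
  by exists v, w; split=> //; rewrite !addr0 !scale0r addr0.
have s0 : 0 < a + b by rewrite lt_neqAle eq_sym ne addr_ge0.
have ha : a = (a + b) * (a / (a + b)) by field.
have hb : b = (a + b) * (b / (a + b)) by field.
have pa : 0 <= a / (a + b) by rewrite divr_ge0 // addr_ge0.
have pb : 0 <= b / (a + b) by rewrite divr_ge0 // addr_ge0.
have pab : a / (a + b) + b / (a + b) <= 1 by rewrite -mulrDl divff.
exists ((a / (a + b)) *: v + (b / (a + b)) *: v').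
exists ((a / (a + b)) *: w + (b / (a + b)) *: w'); split.
- exact: abs_convex_conv.
- exact: abs_convex_conv.
- by rewrite [in RHS]addrACA -!scalerDr [RHS]scalerDr !scalerA -ha -hb.
Qed.

(** The mean value theorem replaces a Hahn-Banach argument: for each disk
    neighbourhood [W] of [0], the set of [s] with
    [c s - c a \in (s - a) (V + W)] propagates along the interval, and the
    sets [V + W] shrink to the closed set [V]. *)
Lemma mean_value (a b : R) (c c' : R -> E) (V : set E) :
  a < b -> closed V -> absolutely_convex V ->
  (forall s, a <= s <= b ->
    r^-1 *: (c (s + r) - c s) @[r --> (0 : R)^'] --> c' s) ->
  (forall s, a <= s <= b -> V (c' s)) ->
  V ((b - a)^-1 *: (c b - c a)).
Proof.
move=> ab clV cV dc Vc'.
have ba0 : 0 < b - a by rewrite subr_gt0.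
suff key (W : set E) : nbhs (0 : E) W -> absolutely_convex W ->
    joinable V W (c b - c a) (b - a).
  set q := _^-1 *: _; apply: clV => N qN.
  have cvq : (fun w : E => q - w) @ (0 : E) --> q - 0.
    by apply: tvs_cvgB; [exact: cvg_cst|exact: cvg_id].
  rewrite subr0 in cvq.
  have N0 : nbhs (0 : E) [set w | N (q - w)] := cvq _ qN.
  have [W [W0 _ cW WN]] := nbhs0_disk N0.
  have [v [w [Vv Ww e]]] := key W W0 cW.
  exists v; split=> //.
  have <- : q - w = v; last exact: WN.
  by rewrite /q e scalerA mulVf ?gt_eqF// scale1r addrK.
move=> W0 cW.
have Va := Vc' a; rewrite lexx (ltW ab) /= in Va; have {}Va := Va isT.
have V0 : V 0 by apply: abs_convex_zero => //; exists (c' a).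
have W00 : W 0 := nbhs_singleton W0.
(* [r] of either sign: the induction arrives at [s] from the left and leaves
   it to the right *)
have loc s : a <= s <= b -> exists2 d : R, 0 < d & forall r,
    r != 0 -> `|r| < d -> W (r^-1 *: (c (s + r) - c s) - c' s).
  move=> sab; apply/dnear0_ball.
  exact: ((tvs_cvgP _ _).1 (dc s sab) W W0).
pose P s := joinable V W (c s - c a) (s - a).
apply: (@real_induction a b P) => //; first exact: ltW.
- by exists 0, 0; split=> //; rewrite !subrr scale0r.
- move=> s sab; have [d d0 Hd] := loc s sab; exists d => // r /andP[ar rs] sdr Pr.
  move: rs; rewrite le_eqVlt => /orP[/eqP <-//|rs].
  have -> : P s = joinable V W ((c r - c a) + (c s - c r)) ((r - a) + (s - r)).
    by rewrite /P; congr joinable; [rewrite [RHS]addrC subrKA|ring].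
  apply: joinable_add => //; rewrite ?subr_ge0 ?(ltW rs)//.
  have rs0 : r - s != 0 by rewrite subr_eq0 lt_eqF.
  have := Hd (r - s) rs0; rewrite ltr0_norm ?subr_lt0//.
  have -> : s + (r - s) = r by ring.
  move=> /(_ ltac:(lra)) Wr; exists (c' s).
  exists ((r - s)^-1 *: (c r - c s) - c' s); split=> //; first exact: Vc'.
  rewrite (addrC (c' s)) subrK scalerA -[c s - _]opprB -[s - r]opprB mulNr.
  by rewrite divff// scaleN1r.
- move=> s /andP[as_ sb] Ps; have sab : a <= s <= b by rewrite as_ ltW.
  have [d d0 Hd] := loc s sab.
  pose r := Num.min (d / 2) (b - s).
  have r0 : 0 < r by rewrite /r lt_min divr_gt0//= subr_gt0.
  have rd : r < d by rewrite /r gt_min; apply/orP; left; lra.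
  have rb : r <= b - s by rewrite /r ge_min lexx orbT.
  exists (s + r); first by apply/andP; split; lra.
  have -> : P (s + r) = joinable V W ((c s - c a) + (c (s + r) - c s))
      ((s - a) + r).
    by rewrite /P; congr joinable; [rewrite [RHS]addrC subrKA|ring].
  apply: joinable_add => //; rewrite ?subr_ge0// ?(ltW r0)//.
  exists (c' s), (r^-1 *: (c (s + r) - c s) - c' s); split=> //.
  + exact: Vc'.
  + by apply: Hd; rewrite ?gt_eqF// gtr0_norm.
  + by rewrite (addrC (c' s)) subrK scalerA divff ?gt_eqF// scale1r.
Qed.

End mean_value.

(** * Directional derivatives *)

Section directional_derivatives.
Context (R : realType) (E F : tvsType R).
Implicit Types (h : E -> F) (x u v w : E).

Lemma dnbhs0_scale (t : R) : t != 0 -> (fun r : R => r * t) @ (0 : R)^' --> (0 : R)^'.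
Proof.
move=> t0 P /dnear0_ball [d d0 dP]; apply/dnear0_ball.
have nt : 0 < `|t| by rewrite normr_gt0.
exists (d / `|t|); first by rewrite divr_gt0.
move=> r r0 rd; apply: dP; first by rewrite mulf_neq0.
by rewrite normrM -ltr_pdivlMr.
Qed.

Lemma has_dderiv_unique h x v (a b : F) : hausdorff_space F ->
  has_dderiv h x v a -> has_dderiv h x v b -> a = b.
Proof. by move=> hF ha hb; exact: (cvg_unique hF ha hb). Qed.

Lemma has_dderivE h x v (a : F) : hausdorff_space F ->
  has_dderiv h x v a -> dderiv h x v = a.
Proof.
move=> hF ha; apply: (has_dderiv_unique hF (h := h) (x := x) (v := v)) => //.
exact: (@xgetPex _ 0 [set w | has_dderiv h x v w] (ex_intro _ a ha)).
Qed.

Lemma has_dderiv_ext h g x v (a : F) :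
  (\forall y \near (0 : R), h (x + y *: v) = g (x + y *: v)) ->
  has_dderiv g x v a -> has_dderiv h x v a.
Proof.
move=> hg ga; rewrite /has_dderiv.
have hg0 : h x = g x by move/nbhs_singleton: hg; rewrite scale0r addr0.
apply: cvg_trans ga; apply: near_eq_cvg.
apply: filterS hg => r e _.
by rewrite e hg0.
Qed.

Lemma has_dderivZ h x v (a : F) (t : R) :
  has_dderiv h x v a -> has_dderiv h x (t *: v) (t *: a).
Proof.
move=> ha; rewrite /has_dderiv; have [->|t0] := eqVneq t 0.
  rewrite !scale0r; under eq_fun do rewrite scaler0 addr0 subrr scaler0.
  exact: cvg_cst.
have : (fun r : R => t *: ((r * t)^-1 *: (h (x + (r * t) *: v) - h x)))
    @ (0 : R)^' --> t *: a.
  apply: tvs_cvgZ; first exact: cvg_cst.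
  apply: (@cvg_comp _ _ _ (fun r : R => r * t)
    (fun r => r^-1 *: (h (x + r *: v) - h x)) _ _ _ _ ha).
  exact: dnbhs0_scale.
apply: cvg_trans; apply: near_eq_cvg.
apply/dnear0_ball; exists 1 => // r r0 _.
by rewrite !scalerA invfM mulrCA divff// mulr1.
Qed.

(** The direction [u] stays fixed and the increment [t] may be negative; the
    translation by [k] compares the derivative with a reference value. *)
Lemma mean_value_dderiv h x u (t : R) (g : R -> F) (k : F) (V : set F) :
  closed V -> absolutely_convex V -> t != 0 ->
  (forall s, 0 <= s <= 1 -> has_dderiv h (x + (s * t) *: u) u (g s)) ->
  (forall s, 0 <= s <= 1 -> V (g s - k)) ->
  V (t^-1 *: (h (x + t *: u) - h x) - k).
Proof.
move=> clV cV t0 dh Vg.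
pose c s := t^-1 *: h (x + (s * t) *: u) - s *: k.
have /= := @mean_value _ _ 0 1 c (fun s => g s - k) V ltr01 clV cV.
rewrite subr0 invr1 scale1r /c mul0r mul1r scale1r !scale0r addr0 subr0.
rewrite addrAC -scalerBr; apply=> // s s01.
have : (fun r : R => (r * t)^-1 *:
    (h (x + (s * t) *: u + (r * t) *: u) - h (x + (s * t) *: u)) - k)
    @ (0 : R)^' --> g s - k.
  apply: tvs_cvgB; last exact: cvg_cst.
  apply: (@cvg_comp _ _ _ (fun r : R => r * t)
    (fun r => r^-1 *: (h (x + (s * t) *: u + r *: u) - h (x + (s * t) *: u)))
    _ _ _ _ (dh s s01)).
  exact: dnbhs0_scale.
apply: cvg_trans; apply: near_eq_cvg.
apply/dnear0_ball; exists 1 => // r r0 _.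
rewrite scalerBr mulrDl scalerDl addrA.
rewrite [RHS](_ : _ = r^-1 *: (t^-1 *: h (x + (s * t) *: u + (r * t) *: u)
  - t^-1 *: h (x + (s * t) *: u) - r *: k)); last first.
  congr (_ *: _); rewrite opprB scalerDl opprD -!addrA; congr (_ + _).
  by rewrite [- (r *: k) + _]addrCA addKr addrC.
by rewrite [RHS]scalerBr [X in _ = X - _]scalerBr !scalerA mulVf// scale1r invfM.
Qed.

(** Continuity of the directional derivative at [(x, w)] makes it strict:
    base point and direction may move together with the increment. *)
Lemma strict_dderiv h (D : set E) (dh : E -> E -> F) x w
    (T : Type) (G : set_system T) {FG : Filter G} (t : T -> R) (X W : T -> E) :
  open D -> D x ->
  (forall y v, D y -> has_dderiv h y v (dh y v)) ->
  (fun p : E * E => dh p.1 p.2) @ (x, w) --> dh x w ->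
  t @ G --> (0 : R) -> (\forall i \near G, t i != 0) ->
  X @ G --> x -> W @ G --> w ->
  (fun i => (t i)^-1 *: (h (X i + t i *: W i) - h (X i))) @ G --> dh x w.
Proof.
move=> oD Dx dh_h cdh t0 tn0 Xx Ww; apply/tvs_cvgP => V' /nbhs0_disk.
move=> [V [V0 clV cV VV']].
have /= [[N1 N2] /= [xN1 wN2] NV] := (tvs_cvgP _ _).1 cdh V V0.
have xD : nbhs x D by exact: open_nbhs_nbhs.
have [C [C0 _ cC CND]] : exists C : set E, [/\ nbhs (0 : E) C, closed C,
    absolutely_convex C & C `<=` [set y | (D `&` N1) (y + x)]].
  apply: nbhs0_disk; apply/(nbhs0_translate _ x).
  by apply: filterS (filterI xD xN1) => y /=; rewrite subrK.
have XtW : (fun i => X i + t i *: W i) @ G --> x.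
  rewrite -[x]addr0 -(scale0r w); apply: tvs_cvgD => //; exact: tvs_cvgZ.
have h1 := (@tvs_cvgP _ _ _ _ FG X x).1 Xx C C0.
have h2 := (@tvs_cvgP _ _ _ _ FG (fun i => X i + t i *: W i) x).1 XtW C C0.
have h3 : \forall i \near G, N2 (W i) by exact: Ww.
near=> i; apply: VV'.
have C1 : C (X i - x) by near: i.
have C2 : C (X i + t i *: W i - x) by near: i.
have WN : N2 (W i) by near: i.
have ti0 : t i != 0 by near: i.
have DN s : 0 <= s <= 1 -> (D `&` N1) (X i + (s * t i) *: W i).
  move=> /andP[s0 s1].
  have e : (1 - s) *: (X i - x) + s *: (X i + t i *: W i - x)
      = X i + (s * t i) *: W i - x.
    rewrite [X i + t i *: _ - x]addrAC [RHS]addrAC [s *: _]scalerDr addrA -scalerDl.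
    by rewrite subrK scale1r scalerA.
  have : C ((1 - s) *: (X i - x) + s *: (X i + t i *: W i - x)).
    by apply: abs_convex_conv => //; lra.
  by rewrite e => /CND; rewrite /mkset subrK.
apply: (@mean_value_dderiv h (X i) (W i) (t i)
  (fun s : R => dh (X i + (s * t i) *: W i) (W i)) (dh x w) V) => //.
  by move=> s /DN [Ds _]; exact: dh_h.
by move=> s /DN [_ Ns]; exact: (NV (_, _) (conj Ns WN)).
Unshelve. all: by end_near. Qed.

Lemma dnbhs0_id : id @ (0 : R)^' --> (0 : R).
Proof. by move=> P /= P0; apply: filterS P0. Qed.

Lemma dnbhs0_neq : \forall t \near (0 : R)^', t != 0.
Proof. by apply/dnear0_ball; exists 1. Qed.

Lemma cvg_line (G : set_system R) {FG : Filter G} x v (W : R -> E) :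
  id @ G --> (0 : R) -> W @ G --> v -> (fun t : R => x + t *: W t) @ G --> x.
Proof.
move=> G0 Wv; rewrite -[X in _ --> X]addr0 -(scale0r v); apply: tvs_cvgD.
  exact: cvg_cst.
exact: tvs_cvgZ.
Qed.

Lemma open_line (D : set E) x v : open D -> D x ->
  \forall t \near (0 : R), D (x + t *: v).
Proof.
move=> oD Dx; have cv : (fun t : R => x + t *: v) @ (0 : R) --> x.
  by apply: (@cvg_line (nbhs (0 : R)) _ x v (fun=> v)); [exact: cvg_id|exact: cvg_cst].
by apply: cv; exact: open_nbhs_nbhs.
Qed.

Lemma has_dderiv_cst (a : F) x v : has_dderiv (fun=> a) x v 0.
Proof.
rewrite /has_dderiv.
under eq_fun do rewrite subrr scaler0.
exact: cvg_cst.
Qed.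

Lemma has_dderivD h g x v (a b : F) : has_dderiv h x v a ->
  has_dderiv g x v b -> has_dderiv (fun y => h y + g y) x v (a + b).
Proof.
move=> ha gb.
have : (fun t : R => t^-1 *: (h (x + t *: v) - h x) +
    t^-1 *: (g (x + t *: v) - g x)) @ (0 : R)^' --> a + b by exact: tvs_cvgD.
apply: cvg_trans; apply: near_eq_cvg; apply: nearW => t.
by rewrite -scalerDr addrACA -opprD.
Qed.

Lemma has_dderivN h x v (a : F) : has_dderiv h x v a ->
  has_dderiv (fun y => - h y) x v (- a).
Proof.
move=> ha; have : (fun t : R => - (t^-1 *: (h (x + t *: v) - h x)))
    @ (0 : R)^' --> - a by exact: tvs_cvgN.
apply: cvg_trans; apply: near_eq_cvg; apply: nearW => t.
by rewrite -scalerN opprD.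
Qed.

Lemma has_dderiv_linear (H : tvsType R) (A : F -> H) h x v (w : F) :
  linear A -> continuous A -> has_dderiv h x v w ->
  has_dderiv (fun y => A (h y)) x v (A w).
Proof.
move=> lA cA hw.
have : (fun t : R => A (t^-1 *: (h (x + t *: v) - h x))) @ (0 : R)^' --> A w.
  exact: (@cvg_comp _ _ _ (fun t : R => t^-1 *: (h (x + t *: v) - h x)) A
    _ _ _ hw (cA w)).
apply: cvg_trans; apply: near_eq_cvg; apply: nearW => t.
by rewrite (linear_at_scale lA) (linear_at_sub lA).
Qed.

(** The increment along [v + w] is one along [v] from [x], then one along [w]
    from the moving point [x + t v]; [strict_dderiv] handles the second. *)
Lemma dderiv_additive h (D : set E) (dh : E -> E -> F) x v w :
  hausdorff_space F -> open D -> D x ->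
  (forall y u, D y -> has_dderiv h y u (dh y u)) ->
  (fun p : E * E => dh p.1 p.2) @ (x, w) --> dh x w ->
  dh x (v + w) = dh x v + dh x w.
Proof.
move=> hF oD Dx dh_h cdh; apply: (has_dderiv_unique hF (dh_h x (v + w) Dx)).
have h1 := dh_h x v Dx.
have h2 : (fun t : R => t^-1 *: (h (x + t *: v + t *: w) - h (x + t *: v)))
    @ (0 : R)^' --> dh x w.
  apply: (@strict_dderiv h D dh x w _ _ _ id (fun t => x + t *: v) (fun=> w)) => //.
  - exact: dnbhs0_id.
  - exact: dnbhs0_neq.
  - by apply: (@cvg_line (0 : R)^' _ x v (fun=> v)); [exact: dnbhs0_id|exact: cvg_cst].
  - exact: cvg_cst.
rewrite /has_dderiv.
apply: cvg_trans (@tvs_cvgD _ _ _ _ _ _ _ _ _ h1 h2).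
apply: near_eq_cvg; apply/dnear0_ball; exists 1 => // t t0 _.
by rewrite (scalerDr t v w) addrA -scalerDr [X in _ *: X]addrC subrKA.
Qed.

End directional_derivatives.

(** * Variations and their chain rule *)

Section variations.
Context (R : realType) (E F : tvsType R).
Implicit Types (f : partial_map E F) (x u w : E).

Definition power_rcons l (v : power E l) u : power E l.+1 :=
  fun i => if unlift ord_max i is Some j then v j else u.

Lemma power_rcons_max l (v : power E l) u : power_rcons v u ord_max = u.
Proof. by rewrite /power_rcons unlift_none. Qed.

Lemma power_rcons_widen l (v : power E l) u i :
  power_rcons v u (widen_ord (leqnSn l) i) = v i.
Proof.
have -> : widen_ord (leqnSn l) i = lift ord_max i.
  by apply: val_inj; exact: esym (lift_max i).
by rewrite /power_rcons liftK.
Qed.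

Lemma power_rcons_eta l (v : power E l.+1) :
  v = power_rcons (fun i => v (widen_ord (leqnSn l) i)) (v ord_max).
Proof.
apply/funext => i; case: (unliftP ord_max i) => [j ->|->]; last first.
  by rewrite power_rcons_max.
rewrite /power_rcons liftK; congr v.
by apply: val_inj; exact: (lift_max j).
Qed.

Lemma variation_has_dderiv f l x (v : power E l) u : hausdorff_space F ->
  Cinfty_c f -> dom f x ->
  has_dderiv (fun y => variation f y v) x u (variation f x (power_rcons v u)).
Proof.
move=> hF [_ /(_ l.+1) [def_ _]] fx.
have [_ [w]] := def_ x (power_rcons v u) fx.
have e : (fun i => power_rcons v u (widen_ord (leqnSn l) i)) = v.
  by apply/funext => i; rewrite power_rcons_widen.
rewrite /= e power_rcons_max => hw.
by rewrite (has_dderivE hF hw).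
Qed.

Lemma variation_cvg f l x (v : power E l) (T : Type) (G : set_system T)
    {FG : Filter G} (X : T -> E) (V : T -> power E l) :
  Cinfty_c f -> dom f x ->
  X @ G --> x -> (forall i, (fun t => V t i) @ G --> v i) ->
  (fun t => variation f (X t) (V t)) @ G --> variation f x v.
Proof.
move=> [of_ /(_ l) [_ cf]] fx Xx Vv.
have op : open [set p : E * power E l | dom f p.1].
  by apply: (@open_comp _ _ (fst : E * power E l -> E)) => // p _; exact: cvg_fst.
move: cf; rewrite continuous_open_subspace// => /(_ (x, v) (mem_set fx)).
move=> /= cf.
apply: (@cvg_comp _ _ _ (fun t => (X t, V t)) (fun p => variation f p.1 p.2)
  G _ _ _ cf).
apply: (@cvg_pair _ _ _ G (nbhs x) (nbhs v)) => //.
exact: power_cvgP.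
Qed.

Lemma variation_rcons_cvg f l x (v : power E l) w : Cinfty_c f -> dom f x ->
  (fun p : E * E => variation f p.1 (power_rcons v p.2)) @ (x, w) -->
  variation f x (power_rcons v w).
Proof.
move=> Cf fx; apply: (@variation_cvg f l.+1 x (power_rcons v w) _ (nbhs (x, w)) _
  fst (fun p : E * E => power_rcons v p.2)) => //; first exact: cvg_fst.
move=> j; case: (unliftP ord_max j) => [j' ->|->]; rewrite /power_rcons.
  by rewrite liftK; exact: cvg_cst.
by rewrite unlift_none; exact: cvg_snd.
Qed.

(** Linearity in the last direction is the additivity of a continuous
    directional derivative; it passes to the earlier directions because
    derivatives of equal functions are equal. *)
Lemma variation_linear f l x (v : power E l) (i : 'I_l) (a : R) u w :
  hausdorff_space F -> Cinfty_c f -> dom f x ->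
  variation f x [eta v with i |-> a *: u + w] =
  a *: variation f x [eta v with i |-> u] + variation f x [eta v with i |-> w].
Proof.
move=> hF Cf; have [of_ _] := Cf.
elim: l x v i => [|l IH] x v i fx; first by case: i.
have vE z : [eta v with i |-> z] = power_rcons
    (fun j => [eta v with i |-> z] (widen_ord (leqnSn l) j))
    ([eta v with i |-> z] ord_max) :> power E l.+1 by exact: power_rcons_eta.
case: (unliftP ord_max i) => [i' iE|iE]; last first.
  pose v' : power E l := fun j => v (widen_ord (leqnSn l) j).
  have e z : [eta v with i |-> z] = power_rcons v' z :> power E l.+1.
    rewrite vE; congr power_rcons; last by rewrite /= iE eqxx.
    apply/funext => j /=; case: eqP => // /(congr1 val) /= jl.
    by have := ltn_ord j; rewrite jl iE ltnn.
  rewrite !e.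
  have dh y z : dom f y -> has_dderiv (fun y => variation f y v') y z
      (variation f y (power_rcons v' z)) by exact: variation_has_dderiv.
  have := @dderiv_additive _ _ _ _ (dom f)
    (fun y z => variation f y (power_rcons v' z)) x (a *: u) w hF of_ fx dh.
  rewrite /= => ->.
    congr (_ + _); apply: (has_dderiv_unique hF (dh x (a *: u) fx)).
    exact/has_dderivZ/dh.
  exact: variation_rcons_cvg.
pose w0 := v ord_max.
pose v' : power E l := fun j => v (widen_ord (leqnSn l) j).
have e z : [eta v with i |-> z] =
    power_rcons [eta v' with i' |-> z] w0 :> power E l.+1.
  rewrite vE; congr power_rcons.
    apply/funext => j /=; congr (if _ then _ else _).
    by rewrite -!val_eqE /= iE lift_max.
  rewrite /= /w0; case: eqP => // /(congr1 val) /= jl.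
  by have := ltn_ord i'; rewrite -[X in (X < _)%N]lift_max -iE -jl ltnn.
rewrite !e.
have dh z : has_dderiv (fun y => variation f y [eta v' with i' |-> z]) x w0
    (variation f x (power_rcons [eta v' with i' |-> z] w0)).
  exact: variation_has_dderiv.
apply: (has_dderiv_unique hF (dh _)).
have hnear := @open_line _ _ (dom f) x w0 of_ fx.
apply: (@has_dderiv_ext _ _ _ _ (fun y => a *: variation f y [eta v' with i' |-> u]
  + variation f y [eta v' with i' |-> w])).
  by apply: filterS hnear => t; exact: IH.
rewrite /has_dderiv; apply: cvg_trans
  (@tvs_cvgD _ _ _ _ _ _ _ _ _
     (@tvs_cvgZ _ _ _ _ _ (fun=> a) _ _ _ (cvg_cst a) (dh u)) (dh w)).
apply: near_eq_cvg; apply/dnear0_ball; exists 1 => // t t0 _ /=.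
by rewrite scalerA mulrC -scalerA -scalerDr scalerBr opprD addrACA.
Qed.

(** Along a differentiable path the variation splits into a telescoping sum,
    in which one argument moves at a time, and a strict derivative in the base
    point. *)
Lemma variation_chain_rule f l x (a tau : power E l) w
    (X : R -> E) (A : R -> power E l) :
  hausdorff_space F -> Cinfty_c f -> dom f x ->
  t^-1 *: (X t - x) @[t --> (0 : R)^'] --> w ->
  (forall i, t^-1 *: (A t i - a i) @[t --> (0 : R)^'] --> tau i) ->
  t^-1 *: (variation f (X t) (A t) - variation f x a) @[t --> (0 : R)^'] -->
  variation f x (power_rcons a w) +
    \sum_(i < l) variation f x [eta a with i |-> tau i].
Proof.
move=> hF Cf fx Xw Atau; have [of_ _] := Cf.
pose W (t : R) := t^-1 *: (X t - x).
pose S (t : R) : power E l := fun i => t^-1 *: (A t i - a i).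
have XE t : t != 0 -> X t = x + t *: W t.
  by move=> t0; rewrite /W scalerA divff// scale1r addrC subrK.
have AE t i : t != 0 -> A t i = t *: S t i + a i.
  by move=> t0; rewrite /S scalerA divff// scale1r subrK.
have Xx : X @ (0 : R)^' --> x.
  apply: cvg_trans (@cvg_line _ _ (0 : R)^' _ x w W (@dnbhs0_id R) Xw).
  by apply: near_eq_cvg; apply: filterS (@dnbhs0_neq R) => t /XE.
have Aa i : (fun t => A t i) @ (0 : R)^' --> a i.
  apply: cvg_trans (@cvg_line _ _ (0 : R)^' _ (a i) (tau i) (fun t => S t i)
    (@dnbhs0_id R) (Atau i)).
  by apply: near_eq_cvg; apply: filterS (@dnbhs0_neq R) => t /AE ->; rewrite addrC.
(* the first [k] arguments have moved to time [t], the others not yet *)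
pose m (k : nat) (t : R) : power E l := fun i => if (i < k)%N then A t i else a i.
have tele t : t != 0 -> dom f (X t) ->
    \sum_(i < l) variation f (X t) [eta m i t with i |-> S t i]
    = t^-1 *: (variation f (X t) (A t) - variation f (X t) a).
  move=> t0 fXt.
  have -> : variation f (X t) (A t) - variation f (X t) a =
      \sum_(0 <= k < l) (variation f (X t) (m k.+1 t) - variation f (X t) (m k t)).
    rewrite (telescope_sumr (fun k => variation f (X t) (m k t)))//.
    congr (variation f _ _ - _).
    by apply/funext => j; rewrite /m ltn_ord.
  rewrite scaler_sumr big_mkord; apply: eq_bigr => i _.
  have -> : m i.+1 t = [eta m i t with i |-> t *: S t i + a i].
    apply/funext => j; rewrite /m /= ltnS leq_eqVlt.
    case: eqP => [/val_inj ->|/= ne]; first by rewrite eqxx -AE.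
    by case: eqP => // ji; case: ne; rewrite ji.
  have mE : m i t = [eta m i t with i |-> a i].
    by apply/funext => j; rewrite /=; case: eqP => // ->; rewrite /m ltnn.
  rewrite (variation_linear _ _ _ _ _ hF Cf)// -mE addrK scalerA mulVf//.
  by rewrite scale1r.
have h1 : (fun t => \sum_(i < l) variation f (X t) [eta m i t with i |-> S t i])
    @ (0 : R)^' --> \sum_(i < l) variation f x [eta a with i |-> tau i].
  apply: tvs_cvg_sum => i; apply: variation_cvg => // j /=.
  case: eqP => _; first exact: Atau.
  by rewrite /m; case: (j < i)%N; [exact: Aa|exact: cvg_cst].
have h2 : (fun t => t^-1 *: (variation f (x + t *: W t) a - variation f x a))
    @ (0 : R)^' --> variation f x (power_rcons a w).
  apply: (@strict_dderiv _ _ _ (fun y => variation f y a) (dom f)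
    (fun y z => variation f y (power_rcons a z)) x w _ (0 : R)^' _ id (fun=> x) W) => //.
  - by move=> y z fy; exact: variation_has_dderiv.
  - exact: variation_rcons_cvg.
  - exact: dnbhs0_id.
  - exact: dnbhs0_neq.
  - exact: cvg_cst.
apply: cvg_trans (@tvs_cvgD _ _ _ _ _ _ _ _ _ h2 h1).
apply: near_eq_cvg.
have fX : \forall t \near (0 : R)^', dom f (X t).
  by apply: Xx; exact: open_nbhs_nbhs.
apply: filterS2 (@dnbhs0_neq R) fX => t t0 fXt.
by rewrite tele// -XE// -scalerDr [X in _ *: X]addrC subrKA.
Qed.

End variations.

Section first_variation.
Context (R : realType) (E F : tvsType R) (f : partial_map E F).
Implicit Types (x v : E).

Lemma dderiv_has_dderiv x v : hausdorff_space F -> Cinfty_c f -> dom f x ->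
  has_dderiv f x v (dderiv f x v).
Proof.
move=> hF Cf fx.
have := @variation_has_dderiv R E F f 0 x (fun=> 0) v hF Cf fx.
by move=> /[dup] /(has_dderivE hF) /= ->.
Qed.

Lemma dderiv_linear x : hausdorff_space F -> Cinfty_c f -> dom f x ->
  linear (dderiv f x).
Proof.
move=> hF Cf fx a u w.
by have := @variation_linear R E F f 1 x (fun=> 0) ord0 a u w hF Cf fx.
Qed.

Lemma dderiv_cvg x v : Cinfty_c f -> dom f x ->
  (fun y => dderiv f y v) @ x --> dderiv f x v.
Proof.
move=> Cf fx; apply: (@variation_cvg R E F f 1 x (fun=> v) _ (nbhs x) _
  id (fun=> (fun=> v)) Cf fx); first exact: cvg_id.
by move=> i; exact: cvg_cst.
Qed.

Lemma dderiv_continuous x : Cinfty_c f -> dom f x -> continuous (dderiv f x).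
Proof.
move=> Cf fx v; apply: (@variation_cvg R E F f 1 x (fun=> v) _ (nbhs v) _
  (fun=> x) (fun w => (fun=> w) : power E 1) Cf fx); first exact: cvg_cst.
by move=> i; exact: cvg_id.
Qed.

Lemma Cinfty_c_continuous x : Cinfty_c f -> dom f x -> f @ x --> f x.
Proof.
move=> Cf fx; apply: (@variation_cvg R E F f 0 x (fun=> 0) _ (nbhs x) _
  id (fun=> (fun=> 0)) Cf fx); first exact: cvg_id.
by case.
Qed.

End first_variation.

(** * Smoothness of an inverse map *)

Section smooth_inverse.
Context (R : realType) (E F : tvsType R) (f : partial_map E F).
Context (Z : set F) (G : F -> E) (Psi : F -> F -> E).
Hypothesis hE : hausdorff_space E.
Hypothesis hF : hausdorff_space F.
Hypothesis Cf : Cinfty_c f.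
Hypothesis Z_open : open Z.
Hypothesis GZ : forall z, Z z -> dom f (G z).
Hypothesis G_cvg : forall z, Z z -> G @ z --> G z.
Hypothesis G_dderiv : forall z v, Z z -> has_dderiv G z v (Psi z v).
Hypothesis Psi_cvg : forall z v, Z z ->
  (fun p : F * F => Psi p.1 p.2) @ (z, v) --> Psi z v.
Hypothesis PsiK : forall z v, Z z -> dderiv f (G z) (Psi z v) = v.
Hypothesis PsiVK : forall z w, Z z -> Psi z (dderiv f (G z) w) = w.

(** [term_fun] is the algebra of functions of a point [z] and a sequence of
    directions [v] that contains [G] and is stable under differentiation in
    [z] along a direction [v j]; so it contains all variations of [G]. *)
Inductive term_fun : (F -> (nat -> F) -> E) -> Prop :=
| term_G : term_fun (fun z _ => G z)
| term_zero : term_fun (fun _ _ => 0)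
| term_add s t : term_fun s -> term_fun t ->
    term_fun (fun z v => s z v + t z v)
| term_opp s : term_fun s -> term_fun (fun z v => - s z v)
| term_dir i : term_fun (fun z v => Psi z (v i))
| term_variation l (s : 'I_l -> F -> (nat -> F) -> E) :
    (forall i, term_fun (s i)) ->
    term_fun (fun z v => Psi z (variation f (G z) (fun i => s i z v))).

Lemma Psi_cvg_comp z v (T : Type) (H : set_system T) {FH : Filter H}
    (X V : T -> F) : Z z -> X @ H --> z -> V @ H --> v ->
  (fun t => Psi (X t) (V t)) @ H --> Psi z v.
Proof.
move=> Zz Xz Vv.
apply: (@cvg_comp _ _ _ (fun t => (X t, V t)) (fun p : F * F => Psi p.1 p.2)
  H _ _ _ (@Psi_cvg z v Zz)).
exact: (@cvg_pair _ _ _ H (nbhs z) (nbhs v)).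
Qed.

Lemma G_cvg_comp z (T : Type) (H : set_system T) {FH : Filter H}
    (X : T -> F) : Z z -> X @ H --> z -> (fun t => G (X t)) @ H --> G z.
Proof. by move=> Zz Xz; apply: (@cvg_comp _ _ _ X G H _ _ Xz (@G_cvg z Zz)). Qed.

Lemma term_fun_cvg h : term_fun h -> forall z v, Z z ->
  forall (T : Type) (H : set_system T) (FH : Filter H) (X : T -> F)
    (V : T -> nat -> F),
  X @ H --> z -> (forall i, (fun t => V t i) @ H --> v i) ->
  (fun t => h (X t) (V t)) @ H --> h z v.
Proof.
elim=> [||s t _ IHs _ IHt|s _ IHs|i|l s _ IHs] z v Zz T H FH X V Xz Vv.
- exact: G_cvg_comp.
- exact: cvg_cst.
- by apply: tvs_cvgD; [exact: IHs|exact: IHt].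
- by apply: tvs_cvgN; exact: IHs.
- exact: Psi_cvg_comp.
- apply: Psi_cvg_comp => //; apply: variation_cvg => //.
  + exact: GZ.
  + exact: G_cvg_comp.
  + by move=> i; exact: IHs.
Qed.


Lemma term_fun_sum (I : Type) (r : seq I) (h : I -> F -> (nat -> F) -> E) :
  (forall i, term_fun (h i)) -> term_fun (fun z v => \sum_(i <- r) h i z v).
Proof.
move=> th; elim: r => [|i r IH].
  have -> : (fun z v => \sum_(i <- [::]) h i z v) = (fun _ _ => 0).
    by apply/funext => z; apply/funext => v; rewrite big_nil.
  exact: term_zero.
have -> : (fun z v => \sum_(i <- i :: r) h i z v) =
    (fun z v => h i z v + \sum_(i <- r) h i z v).
  by apply/funext => z; apply/funext => v; rewrite big_cons.
exact: term_add.
Qed.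

Let Psi_linear z : Z z -> linear (Psi z).
Proof.
move=> Zz a u w; rewrite -[LHS](@PsiVK z _ Zz).
rewrite -{1}(@PsiK z u Zz) -{1}(@PsiK z w Zz).
by rewrite -(dderiv_linear hF Cf (@GZ z Zz)) PsiVK// PsiVK.
Qed.

(** Differentiating [f' (G z) (Psi z u) = u] along a path [u t]. *)
Let Psi_dderiv z j (u : F -> F) u' : Z z ->
  has_dderiv u z j u' ->
  has_dderiv (fun y => Psi y (u y)) z j
    (Psi z (u' - variation f (G z)
      (power_rcons (fun _ : 'I_1 => Psi z (u z)) (Psi z j)))).
Proof.
move=> Zz du; have fG := GZ Zz.
set w := Psi z j; set q := Psi z (u z).
have df0 := linear_at0 (dderiv_linear hF Cf fG).
have zt : (fun t : R => z + t *: j) @ (0 : R)^' --> z.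
  by apply: (@cvg_line _ _ (0 : R)^' _ z j (fun=> j)); [exact: dnbhs0_id|exact: cvg_cst].
have Zt : \forall t \near (0 : R)^', Z (z + t *: j).
  by apply: zt; exact: open_nbhs_nbhs.
have h1 : (fun t : R => t^-1 *: (dderiv f (G (z + t *: j)) q - dderiv f (G z) q))
    @ (0 : R)^' --> variation f (G z) (power_rcons (fun _ : 'I_1 => q) w).
  have := @variation_chain_rule R E F f 1 (G z) (fun=> q) (fun=> 0) w
    (fun t => G (z + t *: j)) (fun _ _ => q) hF Cf fG (@G_dderiv z j Zz).
  rewrite big_ord_recl big_ord0 addr0 /= df0 addr0; apply=> i.
  by under eq_fun do rewrite subrr scaler0; exact: cvg_cst.
have h2 : (fun t : R => Psi (z + t *: j) (t^-1 *: (u (z + t *: j) - u z) -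
    t^-1 *: (dderiv f (G (z + t *: j)) q - dderiv f (G z) q))) @ (0 : R)^' -->
    Psi z (u' - variation f (G z) (power_rcons (fun _ : 'I_1 => q) w)).
  by apply: Psi_cvg_comp => //; exact: (tvs_cvgB du h1).
rewrite /has_dderiv; apply: cvg_trans h2; apply: near_eq_cvg.
apply: filterS Zt => t Zt.
have fGt := GZ Zt.
have lP := Psi_linear Zt.
rewrite -scalerBr (linear_at_scale lP); congr (_ *: _).
rewrite (linear_at_sub lP (_ - _)) !(linear_at_sub lP) PsiVK// PsiK//.
by rewrite opprB addrA subrK.
Qed.

(** Each rule of the algebra has its derivative in the algebra: the derivative
    of [G] is [Psi], and [Psi_dderiv] and the chain rule of the variations
    treat the other constructors. *)
Lemma term_fun_dderiv h (j : nat) : term_fun h ->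
  exists2 h', term_fun h' &
    forall z v, Z z -> has_dderiv (fun y => h y v) z (v j) (h' z v).
Proof.
elim=> [||s t _ [s' ts' ds] _ [t' tt' dt]|s _ [s' ts' ds]|i|l s ts IH].
- by exists (fun z v => Psi z (v j)); [exact: term_dir|move=> z v; exact: G_dderiv].
- exists (fun _ _ => 0); first exact: term_zero.
  by move=> z v _; exact: has_dderiv_cst.
- exists (fun z v => s' z v + t' z v); first exact: term_add.
  by move=> z v Zz; apply: has_dderivD; [exact: ds|exact: dt].
- exists (fun z v => - s' z v); first exact: term_opp.
  by move=> z v Zz; apply: has_dderivN; exact: ds.
- pose p (k : 'I_2) : F -> (nat -> F) -> E :=
    fun z v => power_rcons (fun _ : 'I_1 => Psi z (v i)) (Psi z (v j)) k.
  exists (fun z v => - Psi z (variation f (G z) (fun k => p k z v))).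
    apply/term_opp/term_variation => k; rewrite /p /power_rcons.
    by case: unlift => [_|]; exact: term_dir.
  move=> z v Zz; have du := has_dderiv_cst (v i) z (v j).
  have := Psi_dderiv Zz du.
  by rewrite sub0r -scaleN1r (linear_at_scale (Psi_linear Zz)) scaleN1r.
- have /choice [s' Hs'] : forall i, exists s', term_fun s' /\
      forall z v, Z z -> has_dderiv (fun y => s i y v) z (v j) (s' z v).
    by move=> i; have [s' ts' ds] := IH i; exists s'.
  pose p (k : 'I_l.+1) : F -> (nat -> F) -> E := fun z v =>
    power_rcons (fun i => s i z v) (Psi z (v j)) k.
  (* [p]: derivative in the base point; [q i]: in the argument [i]; [r]: in
     the base point of [Psi] *)
  pose q i (k : 'I_l) : F -> (nat -> F) -> E :=
    if k == i then s' i else s k.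
  pose u z v := Psi z (variation f (G z) (fun i => s i z v)).
  pose r (k : 'I_2) : F -> (nat -> F) -> E := fun z v =>
    power_rcons (fun _ : 'I_1 => u z v) (Psi z (v j)) k.
  exists (fun z v => Psi z (variation f (G z) (fun k => p k z v)) +
      \sum_(i < l) Psi z (variation f (G z) (fun k => q i k z v)) -
      Psi z (variation f (G z) (fun k => r k z v))).
    apply: term_add; first apply: term_add.
    + apply: term_variation => k; rewrite /p /power_rcons.
      by case: unlift => [i|]; [exact: ts|exact: term_dir].
    + apply: term_fun_sum => i; apply: term_variation => k; rewrite /q.
      by case: ifP => _; [case: (Hs' i)|exact: ts].
    + apply/term_opp/term_variation => k; rewrite /r /power_rcons.
      by case: unlift => [_|]; [exact: term_variation|exact: term_dir].
  move=> z v Zz.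
  have du := @variation_chain_rule R E F f l (G z) (fun i => s i z v)
    (fun i => s' i z v) (Psi z (v j)) (fun t => G (z + t *: v j))
    (fun t i => s i (z + t *: v j) v) hF Cf (GZ Zz) (@G_dderiv z (v j) Zz)
    (fun i => (Hs' i).2 z v Zz).
  have := @Psi_dderiv z (v j) (fun y => variation f (G y) (fun i => s i y v))
    _ Zz du.
  have lP := Psi_linear Zz.
  have PsiS (I : Type) (rr : seq I) (a : I -> F) :
      Psi z (\sum_(i <- rr) a i) = \sum_(i <- rr) Psi z (a i).
    elim: rr => [|i rr IHr]; first by rewrite !big_nil (linear_at0 lP).
    by rewrite !big_cons (linear_at_add lP) IHr.
  rewrite (linear_at_sub lP) (linear_at_add lP) PsiS.
  suff -> : \sum_(i < l) Psi z (variation f (G z) (fun k => q i k z v)) =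
    \sum_(i < l) Psi z (variation f (G z)
      [eta (fun i => s i z v) with i |-> s' i z v]) by [].
  apply: eq_bigr => i _; congr (Psi z (variation f _ _)).
  by apply/funext => k; rewrite /q /=; case: (k == i).
Qed.

Lemma variation_term_fun l : exists2 h, term_fun h &
  forall z (v : nat -> F), Z z -> variation G z (fun i : 'I_l => v i) = h z v.
Proof.
elim: l => [|l [h th hE']].
  by exists (fun z _ => G z); first exact: term_G.
have [h' th' dh] := term_fun_dderiv l th.
exists h' => // z v Zz.
apply: (has_dderivE hE); apply: has_dderiv_ext (dh z v Zz).
have := @open_line R F Z z (v l) Z_open Zz.
by apply: filterS => t Zt; rewrite -hE'.
Qed.

(** Directions beyond the given [l] are set to [0]; the variation of order [l]
    does not see them. *)
Let seq_of l (v : power F l) (i : nat) : F :=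
  if insub i is Some j then v j else 0.

Let seq_ofK l (v : power F l) : v = (fun i : 'I_l => seq_of v i).
Proof. by apply/funext => i; rewrite /seq_of valK. Qed.

(** [G] is a continuous map whose derivative [Psi z] inverts [f' (G z)] and is
    jointly continuous. Its variations belong to [term_fun], whose elements
    are continuous; so they all exist and are continuous. *)
Lemma inverse_Cinfty_c : Cinfty_c (PartialMap Z G).
Proof.
split=> // l.
have defined k z (v : nat -> F) : Z z ->
    variation_defined (PartialMap Z G) z (fun i : 'I_k => v i).
  elim: k z => [//|k IH] z Zz.
  split=> /=.
    have := @open_line R F Z z (v k) Z_open Zz.
    by apply: filterS => t Zt; exact: IH.
  have [h th hE'] := variation_term_fun k.
  have [h' th' dh] := term_fun_dderiv k th.
  exists (h' z v); apply: has_dderiv_ext (dh z v Zz).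
  have := @open_line R F Z z (v k) Z_open Zz.
  by apply: filterS => t Zt; rewrite -hE'.
split=> [z v Zz|].
  by rewrite (seq_ofK v); exact: defined.
have oD : open [set p : F * power F l | Z p.1].
  by apply: (@open_comp _ _ (fst : F * power F l -> F)) => // p _; exact: cvg_fst.
rewrite continuous_open_subspace// => -[z v] /set_mem /= Zz.
have [h th hE'] := variation_term_fun l.
have hv : (fun p : F * power F l => h p.1 (seq_of p.2)) @ (z, v) -->
    h z (seq_of v).
  apply: (term_fun_cvg th Zz); first exact: cvg_fst.
  move=> i; rewrite /seq_of; case: insubP => [j _ _|_]; last exact: cvg_cst.
  apply: (@continuous_comp _ _ _ snd (fun p : power F l => p j) (z, v)).
    exact: cvg_snd.
  exact: power_proj_continuous.
rewrite /continuous_at /= [variation G z v](_ : _ = h z (seq_of v)); last first.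
  by rewrite -hE' -?seq_ofK.
apply: cvg_trans hv; apply: near_eq_cvg.
have : nbhs (z, v) [set p : F * power F l | Z p.1] by exact: open_nbhs_nbhs.
by apply: filterS => p Zp /=; rewrite -hE' -?seq_ofK.
Qed.

End smooth_inverse.

(** * Bounded sets and dilated disks *)

Section disks.
Context (R : realType) (E : tvsType R).
Implicit Types (B C S U : set E) (x y : E).

Lemma dilateE B (t : R) x : t != 0 -> dilate t B x <-> B (t^-1 *: x).
Proof.
move=> t0; split=> [[b Bb <-]|Bx]; first by rewrite scalerA mulVf// scale1r.
by exists (t^-1 *: x) => //; rewrite scalerA divff// scale1r.
Qed.

Lemma dilateZ B (a t : R) x : dilate t B x -> dilate (a * t) B (a *: x).
Proof. by move=> [b Bb <-]; exists b => //; rewrite scalerA. Qed.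

Lemma dilateS B (s t : R) x : absolutely_convex B -> `|s| <= `|t| ->
  dilate s B x -> dilate t B x.
Proof.
move=> cB st [b Bb <-]; have [t0|t0] := eqVneq t 0.
  move: st; rewrite t0 normr0 normr_le0 => /eqP ->.
  by exists b.
exists ((s / t) *: b); last by rewrite scalerA mulrC divfK.
apply: abs_convex_scale => //; rewrite normrM normfV ler_pdivrMr ?mul1r//.
by rewrite normr_gt0.
Qed.

Lemma dilate_le B (s t : R) x : absolutely_convex B -> 0 <= s <= t ->
  dilate s B x -> dilate t B x.
Proof.
move=> cB /andP[s0 st]; apply: dilateS => //.
by rewrite !ger0_norm// (le_trans s0).
Qed.

Lemma dilate_subset B C (t : R) x : B `<=` C -> dilate t B x -> dilate t C x.
Proof. by move=> BC [b Bb <-]; exists b => //; exact: BC. Qed.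

Lemma dilateN B (t : R) x : absolutely_convex B ->
  dilate t B x -> dilate t B (- x).
Proof.
by move=> cB [b Bb <-]; exists (- b); [exact: abs_convex_opp|rewrite scalerN].
Qed.

Lemma dilate0 B (t : R) : absolutely_convex B -> B !=set0 -> dilate t B 0.
Proof.
by move=> cB B0; exists 0; [exact: abs_convex_zero|rewrite scaler0].
Qed.

Lemma dilateD B (s t : R) x y : absolutely_convex B -> 0 <= s -> 0 <= t ->
  dilate s B x -> dilate t B y -> dilate (s + t) B (x + y).
Proof.
move=> cB s0 t0 Bx By; have [e|ne] := eqVneq (s + t) 0.
  have e1 : s = 0 by lra.
  have e2 : t = 0 by lra.
  move: Bx By; rewrite e1 e2 addr0 => -[b Bb <-] [b' _ <-].
  by exists b => //; rewrite !scale0r addr0.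
have st0 : 0 < s + t by rewrite lt_neqAle eq_sym ne addr_ge0.
case: Bx By => [b Bb <-] [b' Bb' <-].
exists ((s / (s + t)) *: b + (t / (s + t)) *: b').
  apply: abs_convex_conv => //; rewrite ?divr_ge0 ?(ltW st0)//.
  by rewrite -mulrDl divff.
by rewrite scalerDr !scalerA; congr (_ *: _ + _ *: _); field.
Qed.

Lemma dilate_abs_convex B (t : R) :
  absolutely_convex B -> absolutely_convex (dilate t B).
Proof.
move=> cB _ _ a b [x Bx <-] [y By <-] ab.
exists (a *: x + b *: y); first exact: cB.
by rewrite scalerDr !scalerA ![t * _]mulrC.
Qed.

Lemma dilate_closed B (t : R) : t != 0 -> closed B -> closed (dilate t B).
Proof.
move=> t0 clB; have -> : dilate t B = (fun x : E => t^-1 *: x) @^-1` B.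
  by apply/seteqP; split=> x /=; [move/dilateE|move=> h; apply/dilateE]; auto.
apply: preimage_closed => // x _.
by apply: tvs_cvgZ; [exact: cvg_cst|exact: cvg_id].
Qed.

(** Closedness of [B] lets a gauge bound pass to the infimum. *)
Lemma dilate_inter B (t : R) x : closed B -> absolutely_convex B -> 0 < t ->
  (forall e : R, 0 < e -> dilate (t + e) B x) -> dilate t B x.
Proof.
move=> clB cB t0 H; apply/dilateE; first by rewrite gt_eqF.
apply: clB => N xN.
have : (fun e : R => (t + e)^-1 *: x) @ (0 : R) --> t^-1 *: x.
  apply: tvs_cvgZ; last exact: cvg_cst.
  have te : (fun e : R => t + e) @ (0 : R) --> t + 0.
    by apply: cvgD; [exact: cvg_cst|exact: cvg_id].
  by rewrite addr0 in te; apply: cvgV => //; rewrite gt_eqF.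
move=> /(_ _ xN) /near0_ball [d d0 dN].
exists ((t + d / 2)^-1 *: x); split; last first.
  by apply: dN; rewrite gtr0_norm ?divr_gt0//; lra.
by apply/dilateE; [rewrite gt_eqF// addr_gt0// divr_gt0|apply: H; rewrite divr_gt0].
Qed.

(** Boundedness in the form that limits need; [small_bounded] is the
    converse. *)
Lemma bounded_small B U : vN_bounded B -> nbhs (0 : E) U ->
  exists2 d : R, 0 < d & forall t : R, `|t| <= d -> dilate t B `<=` U.
Proof.
move=> bB U0; have [r r0 rB] := bB U U0.
exists r^-1; first by rewrite invr_gt0.
move=> t td _ [b Bb <-]; have [->|t0] := eqVneq t 0.
  by rewrite scale0r; exact: nbhs_singleton.
have : r <= `|t^-1| by rewrite normfV -[r]invrK lef_pV2 ?posrE ?invr_gt0 ?normr_gt0.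
move=> /rB /(_ b Bb) [u Uu <-].
by rewrite scalerA divff// scale1r.
Qed.

Lemma small_bounded B :
  (forall U, nbhs (0 : E) U ->
    exists2 d : R, 0 < d & forall t : R, `|t| <= d -> dilate t B `<=` U) ->
  vN_bounded B.
Proof.
move=> H U /H [d d0 dU]; exists d^-1; first by rewrite invr_gt0.
move=> s ds b Bb; have s0 : s != 0.
  by rewrite -normr_gt0 (lt_le_trans _ ds)// invr_gt0.
exists (s^-1 *: b); last by rewrite scalerA divff// scale1r.
apply: (dU s^-1); last by exists b.
by rewrite normfV -[d]invrK lef_pV2 ?posrE ?invr_gt0 ?normr_gt0.
Qed.

Lemma bounded_dilate B (s : R) : vN_bounded B -> vN_bounded (dilate s B).
Proof.
move=> bB; apply: small_bounded => U U0.
have [d d0 dU] := bounded_small bB U0.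
have n0 : 0 < `|s| + 1 by rewrite ltr_wpDl.
exists (d / (`|s| + 1)); first by rewrite divr_gt0.
move=> t; rewrite ler_pdivlMr// => td _ [_ [b Bb <-] <-].
rewrite scalerA; apply: (dU (t * s)); last by exists b.
rewrite normrM (le_trans _ td)// ler_wpM2l//; lra.
Qed.

Lemma bounded_point x : vN_bounded [set x].
Proof.
apply: small_bounded => U U0.
have : (fun t : R => t *: x) @ (0 : R) --> 0 *: x.
  by apply: tvs_cvgZ; [exact: cvg_id|exact: cvg_cst].
rewrite scale0r => /(_ _ U0) /near0_ball [d d0 dU].
exists (d / 2); first by rewrite divr_gt0.
by move=> t td _ [_ -> <-]; apply: dU; rewrite (le_lt_trans td)//; lra.
Qed.

(** The gauge of a bounded set is a norm in a Hausdorff space. *)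
Lemma bounded_dilate_eq0 B x : hausdorff_space E -> vN_bounded B ->
  (forall e : R, 0 < e -> dilate e B x) -> x = 0.
Proof.
move=> hE bB H; apply: hE => P Q xP Q0.
have P0 : nbhs (0 : E) [set y | P (x - y)].
  have : (fun y : E => x - y) @ (0 : E) --> x - 0.
    by apply: tvs_cvgB; [exact: cvg_cst|exact: cvg_id].
  by rewrite subr0 => cv; exact: (cv _ xP).
have [d d0 dP] := bounded_small bB P0.
have : P (x - x).
  by apply: (dP d); [rewrite gtr0_norm|exact: H].
rewrite subrr => P00; exists 0; split=> //; exact: nbhs_singleton.
Qed.

End disks.

Section continuous_linear_images.
Context (R : realType) (E F : tvsType R).

Lemma bounded_image (M : E -> F) (B : set E) :
  linear M -> continuous M -> vN_bounded B -> vN_bounded (M @` B).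
Proof.
move=> lM cM bB; apply: small_bounded => U U0.
have M0 := linear_at0 lM.
have MU : nbhs (0 : E) (M @^-1` U) by apply: cM; rewrite M0.
have [d d0 dU] := bounded_small bB MU; exists d => // t td _ [_ [b Bb <-] <-].
have : U (M (t *: b)) by apply: (dU t td); exists b.
by rewrite linear_at_scale.
Qed.

Lemma power_bounded_proj n (i : 'I_n) (D : set (power E n)) :
  vN_bounded D -> vN_bounded [set p i | p in D].
Proof.
move=> bD; apply: small_bounded => U U0.
have : nbhs (0 : power E n) [set p : power E n | U (p i)].
  by apply: (@power_proj_continuous E n i 0).
move=> /(bounded_small bD) [d d0 dU]; exists d => // t td _ [_ [p Dp <-] <-].
by apply: (dU t td (t *: p)); exists p.
Qed.

End continuous_linear_images.

(** * The Mackey closure topology and uniform differentiability *)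

Section mackey_closure_topology.
Context (R : realType).

Lemma mopenP (E : tvsType R) (U : set E) : mopen U <->
  forall x B, U x -> vN_bounded B -> exists2 d : R, 0 < d &
    forall t b, 0 <= t <= d -> B b -> U (x + t *: b).
Proof.
split=> [oU x B Ux bB|oU x Ux B bB].
  have [d d0 dU] := oU x Ux B bB; exists d => // t b td Bb.
  have [u Uu e] := dU t td (t *: b) (ex_intro2 _ _ b Bb erefl).
  by rewrite -e addrC subrK.
have [d d0 dU] := oU x B Ux bB; exists d => // t td _ [b Bb <-].
by exists (x + t *: b); [exact: dU|rewrite addrC addKr].
Qed.

(** Transport to [E^1], where the Mackey closure topology is the given one. *)
Lemma mopen_open (E : tvsType R) (U : set E) :
  cm_convenient E -> mopen U -> open U.
Proof.
move=> [_ _ cmE] /mopenP oU.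
pose P : set (power E 1) := [set p | U (p ord0)].
have oP : open P.
  apply/cmE/mopenP => p D Up bD.
  have [d d0 dU] := oU (p ord0) _ Up (power_bounded_proj ord0 bD).
  by exists d => // t b td Db; apply: dU => //; exists b.
have : open ((fun x => (fun=> x) : power E 1) @^-1` P).
  apply: open_comp => // x _; apply: power_cvgP => i; exact: cvg_id.
by [].
Qed.

(** Likewise with [E^2], in the curried form used for functions of a point and
    a direction. *)
Lemma mopen_open2 (E : tvsType R) (U : E -> E -> Prop) :
  cm_convenient E ->
  (forall x y A B, U x y -> vN_bounded A -> vN_bounded B ->
    exists2 d : R, 0 < d & forall t a b, 0 <= t <= d -> A a -> B b ->
      U (x + t *: a) (y + t *: b)) ->
  open [set p : E * E | U p.1 p.2].
Proof.
move=> [_ _ cmE] oU.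
pose P : set (power E 2) := [set p | U (p ord0) (p ord_max)].
have oP : open P.
  apply/cmE/mopenP => p D Up bD.
  have [d d0 dU] := oU _ _ _ _ Up (power_bounded_proj ord0 bD)
    (power_bounded_proj ord_max bD).
  by exists d => // t b td Db; apply: dU => //; exists b.
have : open ((fun q : E * E =>
    (fun i => if i == ord0 then q.1 else q.2) : power E 2) @^-1` P).
  apply: open_comp => // q _; apply: power_cvgP => i.
  by case: (i == ord0); [exact: cvg_fst|exact: cvg_snd].
by [].
Qed.

End mackey_closure_topology.

Section taylor.
Context (R : realType) (E F : tvsType R) (f : partial_map E F).
Hypothesis hF : hausdorff_space F.
Hypothesis Cf : Cinfty_c f.

(** The second variation is small near [(x; 0, 0)], hence bounded in the
    directions of [K] on [x + t K]; the first derivative is then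
    Lipschitz there, uniformly over [K]. *)
Lemma uniform_dderiv x (K : set E) (U : set F) :
  dom f x -> vN_bounded K -> nbhs (0 : F) U ->
  exists2 d : R, 0 < d & forall t w, t != 0 -> `|t| <= d -> K w ->
    dom f (x + t *: w) /\
    U (t^-1 *: (f (x + t *: w) - f x) - dderiv f x w).
Proof.
move=> fx bK /nbhs0_disk [V [V0 clV cV VU]].
have [of_ _] := Cf.
pose D2 y u := variation f y (power_rcons (fun _ : 'I_1 => u) u).
have hD2 y u : dom f y ->
    has_dderiv (fun y => dderiv f y u) y u (D2 y u).
  by move=> fy; exact: (@variation_has_dderiv R E F f 1 y (fun=> u) u).
have D20 : D2 x 0 = 0.
  apply: (has_dderiv_unique hF (hD2 x 0 fx)).
  by have := has_dderivZ (t := 0) (hD2 x 0 fx); rewrite !scale0r.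
have cD2 : (fun p : E * E => D2 p.1 p.2) @ (x, (0 : E)) --> D2 x 0.
  apply: (@variation_cvg R E F f 2 x _ _ (nbhs (x, (0 : E))) _ fst
    (fun p : E * E => power_rcons (fun _ : 'I_1 => p.2) p.2)) => //.
    exact: cvg_fst.
  by move=> i; rewrite /power_rcons; case: unlift => [_|]; exact: cvg_snd.
have [[N1 N2] /= [xN1 N20] NV] : nbhs (x, (0 : E)) [set p : E * E | V (D2 p.1 p.2)].
  by apply: cD2; rewrite D20.
have xN : nbhs x (dom f `&` N1) by apply: filterI => //; exact: open_nbhs_nbhs.
have [C [C0 _ cC CN]] : exists C : set E, [/\ nbhs (0 : E) C, closed C,
    absolutely_convex C & C `<=` [set y | (dom f `&` N1) (y + x)]].
  apply: nbhs0_disk; apply/(nbhs0_translate _ x).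
  by apply: filterS xN => y /=; rewrite subrK.
have [d1 d10 d1C] := bounded_small bK C0.
have [d2 d20 d2N] := bounded_small bK N20.
pose e := Num.min d1 d2.
have e0 : 0 < e by rewrite lt_min d10.
have ed1 : e <= d1 by rewrite ge_min lexx.
have ed2 : e <= d2 by rewrite ge_min lexx orbT.
have near_x s w : `|s| <= e -> K w -> (dom f `&` N1) (x + s *: w).
  move=> se Kw; rewrite addrC; apply: (CN (s *: w)).
  by apply: (d1C s); [exact: le_trans ed1|exists w].
have lip s w : s != 0 -> `|s| <= e -> `|s| <= e ^+ 2 -> K w ->
    V (dderiv f (x + s *: w) w - dderiv f x w).
  move=> s0 se se2 Kw.
  have se0 : s / e != 0 by rewrite mulf_neq0// invr_neq0// gt_eqF.
  have line t : x + (t * (s / e)) *: (e *: w) = x + (t * s) *: w.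
    by rewrite scalerA mulrA divfK// gt_eqF.
  have := @mean_value_dderiv R E F (fun y => dderiv f y (e *: w)) x (e *: w)
    (s / e) (fun t => D2 (x + (t * s) *: w) (e *: w)) 0 V clV cV se0.
  have -> : x + (s / e) *: (e *: w) = x + s *: w by have := line 1; rewrite !mul1r.
  rewrite subr0 => H.
  have inN t : 0 <= t <= 1 -> `|t * s| <= e.
    move=> /andP[t0 t1]; rewrite normrM (ger0_norm t0).
    by apply: le_trans se; rewrite ler_piMl.
  have {}H : V ((s / e)^-1 *: (dderiv f (x + s *: w) (e *: w) -
      dderiv f x (e *: w))).
    apply: H => t /inN ts.
      by rewrite line; apply: hD2; case: (near_x _ _ ts Kw).
    rewrite subr0; apply: (NV (_, _)); split => /=.
      by case: (near_x _ _ ts Kw).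
    by apply: (d2N e); [rewrite gtr0_norm|exists w].
  have fs := (near_x _ _ se Kw).1.
  rewrite (linear_at_scale (dderiv_linear hF Cf fs)) in H.
  rewrite (linear_at_scale (dderiv_linear hF Cf fx)) in H.
  have -> : dderiv f (x + s *: w) w - dderiv f x w =
     (s / e ^+ 2) *: ((s / e)^-1 *: (e *: dderiv f (x + s *: w) w -
       e *: dderiv f x w)).
    rewrite -scalerBr !scalerA.
    have -> : s / e ^+ 2 / (s / e) * e = 1 by field; rewrite s0 gt_eqF.
    by rewrite scale1r.
  apply: abs_convex_scale => //.
  rewrite normrM normfV (ger0_norm (exprn_ge0 2 (ltW e0))).
  by rewrite ler_pdivrMr ?exprn_gt0// mul1r.
exists (Num.min e (e ^+ 2)); first by rewrite lt_min e0 exprn_gt0.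
move=> t w t0; rewrite le_min => /andP[te te2] Kw.
split; first by case: (near_x _ _ te Kw).
apply: VU; apply: (@mean_value_dderiv R E F f x w t
  (fun s => dderiv f (x + (s * t) *: w) w)) => // s /andP[s0 s1].
  apply: dderiv_has_dderiv => //; apply: (near_x _ _ _ Kw).1.
  by apply: le_trans te; rewrite normrM (ger0_norm s0) ler_piMl.
have [->|sn0] := eqVneq s 0.
  rewrite mul0r scale0r addr0 subrr; exact: nbhs_singleton.
by apply: lip; rewrite ?mulf_neq0//;
  [apply: le_trans te|apply: le_trans te2]; rewrite normrM (ger0_norm s0) ler_piMl.
Qed.

End taylor.

(** * Perturbations of the identity in a Banach disk *)

Section banach_disks.
Context (R : realType) (E : tvsType R).
Implicit Types (B C S : set E) (x y : E).

Lemma dilate_linear_span B (t : R) x : dilate t B x -> linear_span B x.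
Proof.
move=> [b Bb <-]; exists 1%N, (fun=> t), (fun=> b); split=> //.
by rewrite big_ord_recl big_ord0 addr0.
Qed.

Lemma linear_span_disk B x : absolutely_convex B -> B !=set0 ->
  linear_span B x -> disk_span B x.
Proof.
move=> cB B0 [n [c [b [Bb ->]]]].
suff [t t0 Ht] : exists2 t : R, 0 <= t & dilate t B (\sum_(i < n) c i *: b i).
  exists (t + 1); first by rewrite ltr_wpDl.
  by apply: dilate_le Ht => //; rewrite t0 lerDl ler01.
elim/big_ind : _ => [|y z [s s0 sy] [t t0 tz]|i _].
- by exists 0 => //; exact: dilate0.
- by exists (s + t); [exact: addr_ge0|exact: dilateD].
- by exists `|c i| => //; apply: dilateS (_ : `|c i| <= `| `|c i| |) _ => //;
    [rewrite normr_id|exists (b i)].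
Qed.

Lemma minkowski_le B (t : R) x : 0 < t -> dilate t B x -> minkowski B x <= t.
Proof.
by move=> t0 Bx; apply: ge_inf => //; exists 0 => s [/ltW].
Qed.

(** Outside the span of [B] the infimum is over the empty set, hence [0]. *)
Lemma minkowski_lt B (e : R) x : absolutely_convex B ->
  disk_span B x -> minkowski B x < e -> dilate e B x.
Proof.
move=> cB [t t0 Bx] pe.
have hi : [set t : R | 0 < t /\ dilate t B x] !=set0 by exists t.
have [s [s0 sx] se] := inf_lt hi pe.
by apply: dilate_le sx => //; rewrite !ltW.
Qed.

(** Geometric decay in the Minkowski gauge makes a sequence Cauchy in the
    Banach space spanned by [B]; gauge convergence implies convergence in [E]
    because [B] is bounded. *)
Lemma geometric_cvg B (t : R) (u : nat -> E) :
  locally_complete E -> closed B -> absolutely_convex B -> vN_bounded B ->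
  B !=set0 -> 0 <= t ->
  (forall n, dilate (t / 2 ^+ n) B (u n.+1 - u n)) ->
  exists l : E, u @ \oo --> l.
Proof.
move=> lc clB cB bB B0 t0 Hu.
have tn n : 0 <= t / 2 ^+ n by rewrite divr_ge0.
have tle m k : t / 2 ^+ (m + k) <= t / 2 ^+ m.
  apply: ler_wpM2l => //; rewrite lef_pV2 ?posrE ?exprn_gt0//.
  by apply: ler_weXn2l; rewrite ?leq_addr// ler1n.
have diff m k : dilate (2 * (t / 2 ^+ m)) B (u (m + k)%N - u m).
  suff : dilate (2 * (t / 2 ^+ m) - 2 * (t / 2 ^+ (m + k))) B
      (u (m + k)%N - u m).
    by apply: dilate_le => //; have := tle m k; have := tn (m + k)%N; lra.
  elim: k => [|k IH]; first by rewrite addn0 !subrr; exact: dilate0.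
  rewrite addnS -(subrKA (u (m + k)%N)) [X in dilate _ _ X]addrC.
  have -> : 2 * (t / 2 ^+ m) - 2 * (t / 2 ^+ (m + k).+1) =
     (2 * (t / 2 ^+ m) - 2 * (t / 2 ^+ (m + k))) + t / 2 ^+ (m + k).
    by rewrite exprS; field; rewrite !expf_neq0.
  apply: dilateD => //.
  by have := tle m k; lra.
have small (e : R) : 0 < e -> exists N, forall m, (N <= m)%N -> 2 * (t / 2 ^+ m) < e.
  move=> e0; exists (Num.bound (2 * t / e)) => m Nm.
  rewrite mulrA ltr_pdivrMr ?exprn_gt0// [e * _]mulrC -ltr_pdivrMr//.
  have h0 : 0 <= 2 * t / e by rewrite !mulr_ge0// invr_ge0 ltW.
  apply: lt_le_trans (archi_boundP h0) _.
  rewrite -natrX ler_nat (leq_trans Nm)// ltnW// ltn_expl//.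
pose w n := u n - u 0%N.
have [_ _ _ _ complete] := lc B clB cB bB.
have wwE m n : w m - w n = u m - u n.
  by rewrite /w opprB addrA subrK.
have cauchy (e : R) N m k : 0 < e ->
    (forall m, (N <= m)%N -> 2 * (t / 2 ^+ m) < e) -> (N <= m)%N ->
    dilate e B (u (m + k)%N - u m).
  move=> e0 HN Nm; apply: dilate_le (diff m k) => //.
  by rewrite (ltW (HN m Nm)) andbT mulr_ge0.
have [n|e e0|l Bl wl] := complete w.
- exact: dilate_linear_span (diff 0%N n).
- have e20 : 0 < e / 2 by rewrite divr_gt0.
  have [N HN] := small (e / 2) e20.
  exists N => m n Nm Nn; rewrite wwE; apply: (@le_lt_trans _ _ (e / 2)).
    apply: minkowski_le => //; have [mn|/ltnW nm] := leqP m n.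
      by rewrite -opprB -(subnKC mn); apply: dilateN => //; exact: (cauchy _ N).
    by rewrite -(subnKC nm); exact: (cauchy _ N).
  by rewrite ltr_pdivrMr// mulr_natr mulr2n ltrDl.
have [ls ls0 sl] := linear_span_disk cB B0 Bl.
have wls n : disk_span B (w n - l).
  exists (2 * t + ls); first by rewrite ltr_wpDl// mulr_ge0.
  apply: dilateD => //; first by rewrite mulr_ge0.
  - exact: ltW.
  - by have := diff 0%N n; rewrite expr0 divr1.
  - exact: dilateN.
exists (l + u 0%N).
have wl0 : (fun n => w n) @ \oo --> l.
  apply/tvs_cvgP => V V0; have [d d0 dV] := bounded_small bB V0.
  have : \forall n \near \oo, minkowski B (w n - l) < d.
    have dn : \forall r \near (0 : R), r < d.
      by apply/near0_ball; exists d => // r; exact: le_lt_trans (ler_norm _).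
    exact: (wl _ dn).
  apply: filterS => n /(minkowski_lt cB (wls n)).
  by apply: dV; rewrite gtr0_norm.
have : (fun n => w n + u 0%N) @ \oo --> l + u 0%N.
  by apply: tvs_cvgD => //; exact: cvg_cst.
by under eq_fun do rewrite /w subrK.
Qed.

(** The map [x - psi x] is a contraction of ratio [1/2] on [S] for the gauge
    of [C]. *)
Definition near_identity (psi : E -> E) S C := forall x y (t : R),
  S x -> S y -> 0 <= t -> dilate t C (x - y) ->
  dilate (t / 2) C ((x - y) - (psi x - psi y)).

(** If the gauge [p] of [x - y] is at most [T], it is at most [s + T / 2];
    iterating the improvement leads to [2 s]. That [p] is finite at the start
    is what [disk_span C (x - y)] provides. *)
Lemma near_identity_expands psi S C (s : R) x y :
  near_identity psi S C -> closed C -> absolutely_convex C ->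
  S x -> S y -> disk_span C (x - y) -> 0 < s ->
  dilate s C (psi x - psi y) -> dilate (2 * s) C (x - y).
Proof.
move=> npsi clC cC Sx Sy [t t0 xyt] s0 psis.
have H n : dilate (2 * s + t / 2 ^+ n) C (x - y).
  elim: n => [|n IH].
    rewrite expr0 divr1; apply: dilate_le xyt => //.
    by rewrite (ltW t0) lerDr mulr_ge0// ltW.
  have pn : 0 <= 2 * s + t / 2 ^+ n by rewrite addr_ge0// ?mulr_ge0// ltW// divr_gt0.
  have -> : 2 * s + t / 2 ^+ n.+1 = s + (2 * s + t / 2 ^+ n) / 2.
    by rewrite exprS; field; rewrite expf_neq0.
  rewrite -[x - y](subrK (psi x - psi y)) [X in dilate _ _ X]addrC; apply: dilateD => //.
  - exact: ltW.
  - by rewrite divr_ge0.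
  - exact: npsi.
apply: dilate_inter => //; first by rewrite mulr_gt0.
move=> e e0; pose n := Num.bound (t / e).
apply: dilate_le (H n) => //; apply/andP; split.
  by rewrite addr_ge0// ?mulr_ge0// ltW// divr_gt0.
rewrite lerD2l ler_pdivrMr ?exprn_gt0// [e * _]mulrC -ler_pdivrMr//.
have h0 : 0 <= t / e by rewrite divr_ge0// ltW.
apply: le_trans (ltW (archi_boundP h0)) _.
by rewrite -natrX ler_nat ltnW// ltn_expl.
Qed.

Lemma near_identity_inj psi S C x y : hausdorff_space E ->
  near_identity psi S C -> closed C -> absolutely_convex C -> vN_bounded C ->
  S x -> S y -> disk_span C (x - y) -> psi x = psi y -> x = y.
Proof.
move=> hE npsi clC cC bC Sx Sy xyC e; apply/eqP; rewrite -subr_eq0; apply/eqP.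
apply: (bounded_dilate_eq0 hE bC) => r r0.
rewrite -[r](@divfK _ 2)// mulrC.
apply: (near_identity_expands npsi) => //; first by rewrite divr_gt0.
rewrite e subrr; apply: dilate0 => //.
by case: xyC => t _ [b Cb _]; exists b.
Qed.

(** A solution of [psi x = z] is a fixed point of the contraction
    [x |-> x + z - psi x], which exists because the gauge is complete. *)
Lemma near_identity_surj psi S C (t : R) x0 z :
  hausdorff_space E -> locally_complete E ->
  near_identity psi S C -> closed C -> absolutely_convex C -> vN_bounded C ->
  closed S -> (forall x, S x -> psi @ x --> psi x) ->
  S x0 -> (forall x, S x -> S (x + (z - psi x))) ->
  0 <= t -> dilate t C (z - psi x0) ->
  exists2 l, S l & psi l = z.
Proof.
move=> hE lc npsi clC cC bC clS cpsi Sx0 stS t0 zt.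
pose T x := x + (z - psi x); pose u n := iter n T x0.
have Su n : S (u n) by elim: n => //= n IH; exact: stS.
have du n : u n.+1 - u n = z - psi (u n) by rewrite /= /T addrC addKr.
have Hu n : dilate (t / 2 ^+ n) C (u n.+1 - u n).
  elim: n => [|n IH]; first by rewrite du expr0 divr1.
  rewrite du; have := npsi (u n.+1) (u n) (t / 2 ^+ n) (Su _) (Su _).
  have -> : t / 2 ^+ n / 2 = t / 2 ^+ n.+1.
    by rewrite exprS; field; rewrite expf_neq0.
  have -> : u n.+1 - u n - (psi (u n.+1) - psi (u n)) = z - psi (u n.+1).
    by rewrite du opprB addrA subrK.
  by apply=> //; rewrite divr_ge0.
have C0 : C !=set0 by case: zt => b Cb _; exists b.
have [l ul] := geometric_cvg lc clC cC bC C0 t0 Hu.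
have Sl : S l.
  by apply: (@closed_cvg _ _ \oo _ u S clS _ l ul); exact: nearW.
exists l => //.
have h1 : (fun n => psi (u n)) @ \oo --> psi l.
  exact: (@cvg_comp _ _ _ u psi \oo _ _ ul (cpsi l Sl)).
have h2 : (fun n => z - psi (u n)) @ \oo --> z - psi l.
  by apply: tvs_cvgB => //; exact: cvg_cst.
have h3 : (fun n => u n.+1 - u n) @ \oo --> l - l.
  apply: tvs_cvgB => //.
  have sh : (fun n => n.+1) @ \oo --> \oo.
    by move=> P [N _ NP]; exists N => // n Nn; apply: NP; exact: leqW.
  exact: (@cvg_comp _ _ _ (fun n => n.+1) u \oo \oo _ sh ul).
have h4 : (fun n => z - psi (u n)) @ \oo --> l - l.
  by under eq_fun do rewrite -du.
have e : z - psi l = l - l by exact: (cvg_unique hE h2 h4).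
by apply/esym/subr0_eq; rewrite e subrr.
Qed.

End banach_disks.

(** * The local inverse of a tame map *)

Section local_inverse.
Context (R : realType) (E : tvsType R) (f : partial_map E E) (x0 : E).
Context (BB : set (set E)) (M : E -> E).
Hypothesis hE : hausdorff_space E.
Hypothesis cmE : cm_convenient E.
Hypothesis Cf : Cinfty_c f.
Hypothesis genBB : bornological_generator BB.
Hypothesis linM : linear M.
Hypothesis contM : continuous M.
Hypothesis LK : cancel (dderiv f x0) M.
Hypothesis KL : cancel M (dderiv f x0).
Hypothesis tame : forall B v, BB B -> B v ->
  dom f (x0 + 2 *: v) /\
  forall b, B b -> dilate 2^-1 B (b - M (dderiv f (x0 + 2 *: v) b)).

Let lcE : locally_complete E. Proof. by case: cmE. Qed.
Let bornE : bornological E. Proof. by case: cmE. Qed.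

Lemma BB_disk B : BB B ->
  [/\ B !=set0, vN_bounded B, closed B & absolutely_convex B].
Proof. by case: genBB => H _ _; exact: H. Qed.

Let BBc B : BB B -> absolutely_convex B. Proof. by case/BB_disk. Qed.
Let BB0 B : BB B -> B !=set0. Proof. by case/BB_disk. Qed.
Let BBb B : BB B -> vN_bounded B. Proof. by case/BB_disk. Qed.
Let BBcl B : BB B -> closed B. Proof. by case/BB_disk. Qed.

Lemma BB_absorb B (D : set E) : BB B -> vN_bounded D ->
  exists C (s : R), [/\ BB C, B `<=` C, 0 < s & D `<=` dilate s C].
Proof.
move=> BBB bD; have [_ dir gen] := genBB.
have [s s0 [B' BB' DB']] := gen D bD.
have [C BBC BC] := dir B B' BBB BB'.
exists C, s; split=> //; first by move=> x Bx; apply: BC; left.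
by move=> x /DB' [b Bb <-]; exists b => //; apply: BC; right.
Qed.

Lemma BB_nonempty : exists B, BB B.
Proof.
have [_ _ gen] := genBB.
by have [s s0 [B BBB _]] := gen _ (bounded_point (0 : E)); exists B.
Qed.

(** Tameness controls [f' x] at the points [x = x0 + 2 v], whence the radius. *)
Definition dball (C : set E) : set E := [set x | dilate 2 C (x - x0)].

Let dball_center C : BB C -> dball C x0.
Proof. by move=> BC; rewrite /dball /mkset subrr; apply: dilate0; auto. Qed.

Let dball_dom C x : BB C -> dball C x -> dom f x.
Proof.
by move=> BC [v Cv e]; have [] := tame BC Cv; rewrite e addrC subrK.
Qed.

Let tame_dball C x c : BB C -> dball C x -> C c ->
  dilate 2^-1 C (c - M (dderiv f x c)).
Proof.
move=> BC [v Cv e] Cc; have [_] := tame BC Cv.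
by have -> : x0 + 2 *: v = x by [rewrite e addrC subrK]; exact.
Qed.

Let dball_sub B C x : B `<=` C -> dball B x -> dball C x.
Proof. exact: dilate_subset. Qed.

Let dball_conv C x y (t : R) : BB C -> 0 <= t <= 1 -> dball C x -> dball C y ->
  dball C (x + t *: (y - x)).
Proof.
move=> BC /andP[t0 t1] Cx Cy.
have e : (1 - t) *: (x - x0) + t *: (y - x0) = x + t *: (y - x) - x0.
  rewrite scalerBl scale1r -addrA [- _ + _]addrC -scalerBr opprB addrA subrK.
  by rewrite addrAC.
rewrite /dball /mkset -e.
by apply: (abs_convex_conv (dilate_abs_convex (BBc BC))) => //; lra.
Qed.

(** By homogeneity: tameness is the case of a point of [C]. *)
Lemma dderiv_near_identity C x : BB C -> dball C x ->
  near_identity (fun w => M (dderiv f x w)) setT C.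
Proof.
move=> BC Cx a b t _ _ t0 [c Cc e].
have lfx := dderiv_linear hE Cf (dball_dom BC Cx).
rewrite -(linear_at_sub linM) -(linear_at_sub lfx) -e.
rewrite (linear_at_scale lfx) (linear_at_scale linM) -scalerBr.
by apply: dilateZ; exact: tame_dball.
Qed.

(** The ball is convex, so the mean value theorem applies on the segment from
    [y] to [x], with the reference value [c] for the derivative in the
    direction [c = (x - y) / t]. *)
Lemma map_near_identity C : BB C -> near_identity (fun x => M (f x)) (dball C) C.
Proof.
move=> BC x y t Cx Cy t0 [c Cc e].
have [t00|tn0] := eqVneq t 0.
  have -> : x = y by apply/eqP; rewrite -subr_eq0 -e t00 scale0r.
  by rewrite !subrr; apply: dilate0; auto.
pose V := dilate 2^-1 C.
have seg s : 0 <= s <= 1 -> dball C (y + (s * t) *: c).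
  by move=> s01; rewrite -scalerA e; exact: dball_conv.
have := @mean_value_dderiv R E E (fun x => M (f x)) y c t
  (fun s => M (dderiv f (y + (s * t) *: c) c)) c V.
have -> : y + t *: c = x by rewrite e addrC subrK.
move=> H.
have {H} : V (t^-1 *: (M (f x) - M (f y)) - c).
  apply: H => //.
  - by apply: dilate_closed; auto.
  - by apply: dilate_abs_convex; auto.
  - move=> s /seg Cs; apply: has_dderiv_linear => //.
    by apply: dderiv_has_dderiv => //; exact: dball_dom Cs.
  - move=> s /seg Cs; rewrite -opprB; apply: dilateN; first by auto.
    exact: tame_dball.
move=> Vc; have -> : x - y - (M (f x) - M (f y)) =
    t *: - (t^-1 *: (M (f x) - M (f y)) - c).
  by rewrite [in RHS]opprB (scalerBr t) scalerA divff// scale1r e.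
by apply: dilateZ; apply: dilateN; auto.
Qed.

(** The condition [r < 1] leaves room to add small multiples of larger disks,
    which makes this set mopen. *)
Definition disk_hull : set E :=
  [set x | exists C (r : R), [/\ BB C, 0 < r < 1 & dilate r C x]].

Lemma disk_hull_absorb x (D : set E) : disk_hull x -> vN_bounded D ->
  exists C (r s : R),
    [/\ BB C, 0 < r < 1, dilate r C x, 0 < s & D `<=` dilate s C].
Proof.
move=> [B [r [BBB r01 Bx]]] bD.
have [C [s [BC sBC s0 DC]]] := BB_absorb BBB bD.
by exists C, r, s; split=> //; exact: dilate_subset Bx.
Qed.

Lemma disk_hull_open : open disk_hull.
Proof.
apply: mopen_open => //; apply/mopenP => x D Ox bD.
have [C [r [s [BC /andP[r0 r1] Cx s0 DC]]]] := disk_hull_absorb Ox bD.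
(* then [r + t s <= (1 + r) / 2 < 1] *)
exists ((1 - r) / (2 * s)); first by rewrite divr_gt0 ?subr_gt0// mulr_gt0.
move=> t b /andP[t0 td] /DC Db; exists C, (r + t * s).
have ts : t * s <= (1 - r) / 2.
  by move: td; rewrite invfM mulrA ler_pdivlMr.
have ts0 : 0 <= t * s by rewrite mulr_ge0// ltW.
split=> //; first by apply/andP; split; lra.
by apply: dilateD; [auto|exact: ltW|by []|by []|exact: dilateZ].
Qed.

(** The inverse of [M \o f] at most doubles gauges, so a point of [target] of
    gauge [r] has its preimage at gauge [2 r]. *)
Definition source : set E := [set x | disk_hull (2^-1 *: (x - x0))].
Definition target : set E := [set z | disk_hull (M (z - f x0))].

Lemma in_dball C (r : R) x : BB C -> 0 < r < 1 -> dilate (2 * r) C (x - x0) ->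
  dball C x.
Proof.
move=> BC /andP[r0 r1]; apply: dilate_le; first by auto.
by apply/andP; split; lra.
Qed.

Lemma source_dball x : source x -> exists2 C, BB C & dball C x.
Proof.
move=> [C [r [BC r01 H]]]; exists C => //; apply: (in_dball BC r01).
by have := dilateZ 2 H; rewrite scalerA divff// scale1r.
Qed.

(** Two points lie in a common ball because the generator is directed. *)
Lemma map_inj_on_source x y : source x -> source y -> f x = f y -> x = y.
Proof.
move=> /source_dball [B BBB Bx] /source_dball [B' BBB' By] e.
have [_ dir _] := genBB; have [C BC sC] := dir B B' BBB BBB'.
have Cx : dball C x by apply: dball_sub Bx => b Bb; apply: sC; left.
have Cy : dball C y by apply: dball_sub By => b Bb; apply: sC; right.
apply: (near_identity_inj hE (map_near_identity BC)); auto.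
  exists (2 + 2) => //.
  have -> : x - y = (x - x0) + - (y - x0) by rewrite opprB addrA subrK.
  by apply: dilateD; auto; apply: dilateN; auto.
by rewrite e.
Qed.

(** The iteration solving [M (f x) = M z] from [x0] stays in [x0 + 2 r C]:
    each step adds at most [r] to half of the previous gauge. *)
Lemma map_surj_dball C (r : R) z : BB C -> 0 < r < 1 ->
  dilate r C (M (z - f x0)) ->
  exists2 x, dilate (2 * r) C (x - x0) & f x = z.
Proof.
move=> BC r01 Cz; have [r0 r1] := andP r01.
pose S : set E := [set x | dilate (2 * r) C (x - x0)].
have SC x : S x -> dball C x by exact: in_dball.
have [l Sl e] : exists2 l, S l & M (f l) = M z.
  apply: (@near_identity_surj R E (fun x => M (f x)) S C r x0 (M z)); auto.
  - by move=> x y t /SC Sx /SC Sy; exact: map_near_identity.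
  - have clD : closed (dilate (2 * r) C).
      by apply: dilate_closed; [rewrite gt_eqF// mulr_gt0|auto].
    apply: preimage_closed clD => x _.
    by apply: tvs_cvgB; [exact: cvg_id|exact: cvg_cst].
  - move=> x /SC Sx.
    apply: (@continuous_comp _ _ _ (pval f) M x); last exact: contM.
    by apply: Cinfty_c_continuous => //; exact: dball_dom Sx.
  - by rewrite /S /mkset subrr; apply: dilate0; auto.
  - move=> x Sx; rewrite /S /mkset.
    have -> : x + (M z - M (f x)) - x0 = (M z - M (f x0)) +
        ((x - x0) - (M (f x) - M (f x0))).
      rewrite opprB [x - x0 + _]addrC [RHS]addrA subrKA.
      by rewrite [LHS]addrAC [LHS]addrC.
    have e2 : 2 * r = r + 2 * r / 2 by lra.
    rewrite {1}e2.
    apply: dilateD; auto.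
    + by rewrite divr_ge0// mulr_ge0// ltW.
    + by rewrite -(linear_at_sub linM).
    + apply: map_near_identity => //; first exact: SC.
      * exact: dball_center.
      * by rewrite mulr_ge0// ltW.
  - by rewrite -(linear_at_sub linM).
by exists l => //; apply: (can_inj KL).
Qed.

Lemma target_open : open target.
Proof.
have : open ((fun z => M (z - f x0)) @^-1` disk_hull).
  apply: open_comp disk_hull_open => z _.
  apply: (@continuous_comp _ _ _ (fun z => z - f x0) M z); last exact: contM.
  by apply: tvs_cvgB; [exact: cvg_id|exact: cvg_cst].
by [].
Qed.

(** * Inverses of the derivatives *)

Definition dderiv_inv x v : E := xget 0 [set w | dderiv f x w = v].

(** Any two vectors lie in the span of some disk larger than [C], and [x] is in
    the ball of every larger disk; so injectivity in each gauge is enough. *)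
Lemma dderiv_inj C x : BB C -> dball C x -> injective (dderiv f x).
Proof.
move=> BC Cx w w' e.
have [C' [s [BC' CC' s0 Hs]]] := BB_absorb BC (bounded_point (w - w')).
apply: (near_identity_inj hE (dderiv_near_identity BC' (dball_sub CC' Cx))).
- exact: BBcl.
- exact: BBc.
- exact: BBb.
- by [].
- by [].
- by exists s => //; exact: Hs.
- by rewrite e.
Qed.

(** Restricting the iteration to [2 s C] yields the solution together with the
    bound on its gauge. *)
Lemma dderiv_solve C x v (s : R) : BB C -> dball C x -> 0 < s ->
  dilate s C (M v) -> exists2 w, dilate (2 * s) C w & dderiv f x w = v.
Proof.
move=> BC Cx s0 sv; have fx := dball_dom BC Cx.
have lfx := dderiv_linear hE Cf fx.
have [w Sw e] : exists2 w, dilate (2 * s) C w & M (dderiv f x w) = M v.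
  apply: (@near_identity_surj R E (fun w => M (dderiv f x w))
    (dilate (2 * s) C) C s 0 (M v)) => //.
  - by move=> a b t _ _; exact: dderiv_near_identity.
  - exact: BBcl.
  - exact: BBc.
  - exact: BBb.
  - by apply: dilate_closed; [rewrite gt_eqF// mulr_gt0|exact: BBcl].
  - move=> w _; apply: (@continuous_comp _ _ _ (dderiv f x) M w).
      exact: dderiv_continuous.
    exact: contM.
  - by apply: dilate0; [exact: BBc|exact: BB0].
  - move=> w Sw; rewrite addrCA.
    have e2 : 2 * s = s + 2 * s / 2 by lra.
    rewrite {1}e2; apply: dilateD => //.
    + exact: BBc.
    + exact: ltW.
    + by rewrite divr_ge0// mulr_ge0// ltW.
    + have /= := @dderiv_near_identity C x BC Cx w 0 (2 * s) I I.
      rewrite (linear_at0 lfx) (linear_at0 linM) !subr0; apply => //.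
      by rewrite mulr_ge0// ltW.
  - exact: ltW.
  - by rewrite (linear_at0 lfx) (linear_at0 linM) subr0.
by exists w => //; apply: (can_inj KL).
Qed.

Lemma dderiv_invK C x v : BB C -> dball C x -> dderiv f x (dderiv_inv x v) = v.
Proof.
move=> BC Cx.
have [C' [s [BC' CC' s0 Hs]]] := BB_absorb BC (bounded_point (M v)).
have [w _ e] := dderiv_solve BC' (dball_sub CC' Cx) s0 (Hs _ erefl).
exact: (@xgetPex _ 0 [set w | dderiv f x w = v] (ex_intro _ w e)).
Qed.

Lemma dderivK C x w : BB C -> dball C x -> dderiv_inv x (dderiv f x w) = w.
Proof. by move=> BC Cx; apply: (dderiv_inj BC Cx); rewrite (dderiv_invK _ BC Cx). Qed.

Lemma dderiv_inv_linear C x : BB C -> dball C x -> linear (dderiv_inv x).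
Proof.
move=> BC Cx a u w; apply: (dderiv_inj BC Cx).
by rewrite (dderiv_linear hE Cf (dball_dom BC Cx)) !(dderiv_invK _ BC Cx).
Qed.

Lemma dderiv_inv_bound C x v (s : R) : BB C -> dball C x -> 0 < s ->
  dilate s C (M v) -> dilate (2 * s) C (dderiv_inv x v).
Proof.
move=> BC Cx s0 sv; have [w Sw <-] := dderiv_solve BC Cx s0 sv.
by rewrite (dderivK _ BC Cx).
Qed.

(** The set of [v] that all the [dderiv_inv x], for [x] in a ball, map into a
    disk [V] absorbs bounded sets by [dderiv_inv_bound]; so it is a
    neighbourhood of [0] in the bornological space [E]. *)
Lemma dderiv_inv_equicontinuous C U : BB C -> nbhs (0 : E) U ->
  exists2 W, nbhs (0 : E) W & forall x v, dball C x -> W v -> U (dderiv_inv x v).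
Proof.
move=> BC /nbhs0_disk [V [V0 _ cV VU]].
exists [set v | forall x, dball C x -> V (dderiv_inv x v)]; last first.
  by move=> x v Cx Wv; apply: VU; exact: Wv.
apply: bornE => [u v a b Wu Wv ab x Cx|D bD].
  have lP := dderiv_inv_linear BC Cx.
  rewrite (linear_at_add lP) !(linear_at_scale lP).
  by apply: cV => //; [exact: Wu|exact: Wv].
have [C' [s [BC' CC' s0 Hs]]] := BB_absorb BC (bounded_image linM contM bD).
have [d d0 dV] := bounded_small (BBb BC') V0.
exists (2 * s / d); first by rewrite divr_gt0// mulr_gt0.
move=> t st b Db.
have t0 : t != 0 by rewrite -normr_gt0 (lt_le_trans _ st)// divr_gt0// mulr_gt0.
exists (t^-1 *: b); last by rewrite scalerA divff// scale1r.
move=> x Cx; rewrite (linear_at_scale (dderiv_inv_linear BC Cx)).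
apply: (dV (t^-1 * (2 * s))).
  rewrite normrM normfV (gtr0_norm (mulr_gt0 _ s0))//.
  rewrite mulrC ler_pdivrMr ?normr_gt0//.
  by rewrite -ler_pdivrMl// mulrC.
apply: dilateZ; apply: dderiv_inv_bound => //; first exact: dball_sub Cx.
by apply: Hs; exists b.
Qed.

(** * Continuity and derivative of the inverse map *)

Section inverse_map.
Context (G : E -> E).
Hypothesis GP : forall z, target z -> source (G z) /\ f (G z) = z.

Lemma G_dball C (r : R) z : BB C -> 0 < r < 1 ->
  dilate r C (M (z - f x0)) -> dball C (G z).
Proof.
move=> BC r01 Cz.
have Zz : target z by exists C, r.
have [x Cx fxz] := map_surj_dball BC r01 Cz.
have -> : G z = x; last exact: (in_dball BC r01).
apply: map_inj_on_source; [by case: (GP Zz)| |by case: (GP Zz) => _ ->].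
exists C, r; split=> //.
by have := dilateZ 2^-1 Cx; rewrite mulrA mulVf// mul1r.
Qed.

(** For directions in a bounded set, [z] and its translates lie in one disk,
    whose gauge [G] at most doubles: [G] is Lipschitz in the Mackey sense. *)
Lemma G_increment z (D : set E) : target z -> vN_bounded D ->
  exists C (s d : R), [/\ BB C, 0 < s, 0 < d, dball C (G z) &
    forall t b, `|t| <= d -> D b ->
      [/\ target (z + t *: b), dball C (G (z + t *: b)) &
          dilate (2 * (t * s)) C (G (z + t *: b) - G z)]].
Proof.
move=> Zz bD.
have [C [r [s [BC /andP[r0 r1] Cz s0 DC]]]] :=
  disk_hull_absorb Zz (bounded_image linM contM bD).
pose r' := (1 + r) / 2.
have r'01 : 0 < r' < 1 by rewrite /r'; apply/andP; split; lra.
have Cz0 : dilate r' C (M (z - f x0)).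
  by apply: dilate_le Cz; [exact: BBc|rewrite /r'; apply/andP; split; lra].
have B1 := G_dball BC r'01 Cz0.
exists C, s, ((1 - r) / (2 * s)); split=> //.
  by rewrite divr_gt0 ?subr_gt0// mulr_gt0.
move=> t b td Db.
have ts : `|t| * s <= (1 - r) / 2.
  by move: td; rewrite invfM mulrA ler_pdivlMr.
have ts0 : 0 <= `|t| * s by rewrite mulr_ge0// ltW.
have Mb : dilate (t * s) C (t *: M b) by apply: dilateZ; apply: DC; exists b.
have Mb' : dilate (`|t| * s) C (t *: M b).
  by apply: dilateS Mb; [exact: BBc|rewrite !normrM normr_id].
have Czt : dilate r' C (M (z + t *: b - f x0)).
  rewrite addrAC (linear_at_add linM) (linear_at_scale linM).
  apply: (@dilate_le _ _ _ (r + `|t| * s)); first exact: BBc.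
    by rewrite /r'; apply/andP; split; lra.
  by apply: dilateD => //; [exact: BBc|exact: ltW].
have Zt : target (z + t *: b) by exists C, r'.
have B2 := G_dball BC r'01 Czt.
split=> //.
have [->|t0] := eqVneq t 0.
  rewrite scale0r addr0 subrr; apply: dilate0; [exact: BBc|exact: BB0].
apply: (@dilateS _ _ _ (2 * (`|t| * s))); first exact: BBc.
  by rewrite !normrM normr_id.
apply: (near_identity_expands (map_near_identity BC)) => //.
- exact: BBcl.
- exact: BBc.
- exists (2 + 2) => //.
  have -> : G (z + t *: b) - G z = (G (z + t *: b) - x0) + - (G z - x0).
    by rewrite opprB addrA subrK.
  by apply: dilateD => //; [exact: BBc|apply: dilateN => //; exact: BBc].
- by rewrite mulr_gt0// normr_gt0.
- rewrite (GP Zt).2 (GP Zz).2 -(linear_at_sub linM) addrAC subrr add0r.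
  by rewrite (linear_at_scale linM).
Qed.

(** [G_increment] makes preimages of open sets mopen. *)
Lemma G_continuous z : target z -> G @ z --> G z.
Proof.
move=> Zz U /=; rewrite nbhsE => -[V [oV VG] VU].
pose P : set E := [set z | target z /\ V (G z)].
have oP : open P.
  apply: mopen_open => //; apply/mopenP => y D [Zy VGy] bD.
  have [C [s [d [BC s0 d0 _ H]]]] := G_increment Zy bD.
  have V0 : nbhs (0 : E) [set u | V (u + G y)].
    apply/(nbhs0_translate _ (G y)).
    have : nbhs (G y) V by exact: open_nbhs_nbhs.
    by apply: filterS => u /=; rewrite subrK.
  have [e e0 eV] := bounded_small (BBb BC) V0.
  exists (Num.min d (e / (2 * s))).
    by rewrite lt_min d0 divr_gt0// mulr_gt0.
  move=> t b /andP[t0]; rewrite le_min => /andP[td te] Db.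
  have tn : `|t| <= d by rewrite ger0_norm.
  have [Zt _ Ct] := H t b tn Db.
  split=> //; have := eV (2 * (t * s)) _ _ Ct; rewrite /mkset subrK; apply.
  rewrite ger0_norm; last by rewrite mulr_ge0// mulr_ge0// ltW.
  by rewrite mulrCA -ler_pdivlMr// mulr_gt0.
have : nbhs z P by apply: open_nbhs_nbhs; split=> //; split.
by apply: filterS => y [_ /VU].
Qed.

(** With [x' = G (z + t a)] and [w = f' x ^-1 u], the increment is
    [f' x' ^-1 (u + t b) - w = f' x' ^-1 (t b + (f' x w - f' x' w))].
    The argument on the right tends to [0] by continuity of [f'], and the
    maps [f' x' ^-1] are equicontinuous. *)
Lemma dderiv_inv_cvg z v : target z ->
  (fun p : E * E => dderiv_inv (G p.1) p.2) @ (z, v) --> dderiv_inv (G z) v.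
Proof.
move=> Zz U /=; rewrite nbhsE => -[V [oV VG] VU].
pose P (z v : E) := target z /\ V (dderiv_inv (G z) v).
have oP : open [set p : E * E | P p.1 p.2].
  apply: mopen_open2 => // y u A B [Zy Vyu] bA bB.
  have [C [s [d [BC s0 d0 Cx H]]]] := G_increment Zy bA.
  set x := G y in Vyu Cx H *; set w := dderiv_inv x u in Vyu *.
  have V0 : nbhs (0 : E) [set q | V (q + w)].
    apply/(nbhs0_translate _ w).
    have : nbhs w V by exact: open_nbhs_nbhs.
    by apply: filterS => q /=; rewrite subrK.
  have [W W0 WV] := dderiv_inv_equicontinuous BC V0.
  have [W' W'0 WW] := nbhs0_half W0.
  have [e1 e10 e1W] := bounded_small bB W'0.
  have fx := dball_dom BC Cx.
  have X0 : nbhs (0 : E) [set q | W' (dderiv f x w - dderiv f (q + x) w)].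
    apply/(nbhs0_translate _ x).
    have : (fun y => dderiv f x w - dderiv f y w) @ x -->
        dderiv f x w - dderiv f x w.
      by apply: tvs_cvgB; [exact: cvg_cst|exact: dderiv_cvg].
    rewrite subrr => cv.
    have h : nbhs x [set y | W' (dderiv f x w - dderiv f y w)] := cv _ W'0.
    by apply: filterS h => y'; rewrite /mkset subrK.
  have [e2 e20 e2W] := bounded_small (BBb BC) X0.
  exists (Num.min d (Num.min e1 (e2 / (2 * s)))).
    by rewrite !lt_min d0 e10 divr_gt0// mulr_gt0.
  move=> t a b /andP[t0]; rewrite !le_min => /and3P[td te1 te2] Aa Bb.
  have tn : `|t| <= d by rewrite ger0_norm.
  have [Zt Bt Ct] := H t a tn Aa.
  split=> //; set x' := G (y + t *: a) in Bt Ct *.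
  have W1 : W' (t *: b) by apply: (e1W t); [rewrite ger0_norm|exists b].
  have W2 : W' (dderiv f x w - dderiv f x' w).
    have := e2W (2 * (t * s)) _ _ Ct; rewrite /mkset subrK; apply.
    rewrite ger0_norm; last by rewrite mulr_ge0// mulr_ge0// ltW.
    by rewrite mulrCA -ler_pdivlMr// mulr_gt0.
  have := WV x' _ Bt (WW _ _ W1 W2); rewrite /mkset.
  have -> : dderiv_inv x' (t *: b + (dderiv f x w - dderiv f x' w)) + w =
      dderiv_inv x' (u + t *: b); last by [].
  rewrite (dderiv_invK _ BC Cx) addrA (linear_at_sub (dderiv_inv_linear BC Bt)).
  by rewrite (dderivK _ BC Bt) subrK addrC.
have : nbhs (z, v) [set p : E * E | P p.1 p.2].
  by apply: open_nbhs_nbhs; split=> //; split.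
by apply: filterS => y [_ /VU].
Qed.

(** The difference quotient [w] of [G] stays in a bounded set; hence
    [v - f' x w], the remainder of [f] at [x = G z], tends to [0], and
    [f' x ^-1] carries this to [w]. *)
Lemma G_dderiv z v : target z -> has_dderiv G z v (dderiv_inv (G z) v).
Proof.
move=> Zz; rewrite /has_dderiv; apply/tvs_cvgP => U U0.
have [C [s [d [BC s0 d0 Cx H]]]] := G_increment Zz (bounded_point v).
set x := G z in H Cx *; have fx := dball_dom BC Cx.
have [W W0 WU] := dderiv_inv_equicontinuous BC (nbhs0_scale (-1) U0).
have [W' [W'0 _ cW' W'W]] := nbhs0_disk W0.
have [e e0 eW] := uniform_dderiv hE Cf fx (bounded_dilate (2 * s) (BBb BC)) W'0.
apply/dnear0_ball; exists (Num.min d e); first by rewrite lt_min d0.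
move=> t t0; rewrite lt_min => /andP[td te].
have [Zt Bt Ct] := H t v (ltW td) erefl.
pose w := t^-1 *: (G (z + t *: v) - x).
have Kw : dilate (2 * s) C w.
  have := dilateZ t^-1 Ct; rewrite (_ : t^-1 * (2 * (t * s)) = 2 * s)//.
  by field.
have xw : x + t *: w = G (z + t *: v).
  by rewrite /w scalerA divff// scale1r addrC subrK.
have [_] := eW t w t0 (ltW te) Kw.
rewrite xw (GP Zt).2 (GP Zz).2 addrAC subrr add0r scalerA mulVf// scale1r.
move=> /W'W /(WU x _ Cx); rewrite /mkset (linear_at_sub (dderiv_inv_linear BC Cx)).
by rewrite (dderivK _ BC Cx) scaleN1r opprB.
Qed.

Lemma local_inverse_Cinfty_c : Cinfty_c (PartialMap target G).
Proof.
apply: (@inverse_Cinfty_c R E E f target G (fun z => dderiv_inv (G z))) => //.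
- exact: target_open.
- by move=> z /GP [/source_dball [C BC Cx] _]; exact: dball_dom Cx.
- exact: G_continuous.
- by move=> z v; exact: G_dderiv.
- by move=> z v; exact: dderiv_inv_cvg.
- by move=> z v /GP [/source_dball [C BC Cx] _]; exact: dderiv_invK Cx.
- by move=> z v /GP [/source_dball [C BC Cx] _]; exact: dderivK Cx.
Qed.

End inverse_map.

Lemma local_inverse : exists U : set E,
  [/\ open U, U x0, pinjective (prestrict f U) &
      Cinfty_c (pinverse (prestrict f U))].
Proof.
have source_dom x : source x -> dom f x.
  by move=> /source_dball [C BC Cx]; exact: dball_dom Cx.
pose U : set E := [set x | source x /\ target (f x)].
have source_open : open source.
  have : open ((fun x => 2^-1 *: (x - x0)) @^-1` disk_hull).
    apply: open_comp disk_hull_open => x _.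
    apply: tvs_cvgZ; first exact: cvg_cst.
    by apply: tvs_cvgB; [exact: cvg_id|exact: cvg_cst].
  by [].
have hull0 : disk_hull 0.
  have [C BC] := BB_nonempty.
  exists C, 2^-1; split=> //; first by apply/andP; split; lra.
  by apply: dilate0; [exact: BBc|exact: BB0].
have inj : set_inj (U `&` dom f) f.
  move=> x y /set_mem [[Nx _] _] /set_mem [[Ny _] _]; exact: map_inj_on_source.
have img : f @` (U `&` dom f) = target.
  apply/seteqP; split=> [_ [x [[_ Zx] _] <-]//|z Zz].
  have [C [r [BC r01 Cz]]] := Zz.
  have [x Cx e] := map_surj_dball BC r01 Cz; exists x => //.
  have Nx : source x.
    exists C, r; split=> //.
    by have := dilateZ 2^-1 Cx; rewrite mulrA mulVf// mul1r.
  by split; [split=> //; rewrite e|exact: source_dom].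
exists U; split=> //.
- rewrite openE => x [Nx Zx].
  have h1 : nbhs x source by exact: open_nbhs_nbhs.
  have h2 : nbhs (f x) target.
    by apply: open_nbhs_nbhs; split=> //; exact: target_open.
  have h3 : nbhs x (f @^-1` target).
    by apply: (Cinfty_c_continuous Cf (source_dom _ Nx)).
  exact: filterI h1 h3.
- split; first by rewrite /source /mkset subrr scaler0.
  by rewrite /target /mkset subrr (linear_at0 linM).
- rewrite /pinverse /= img; apply: local_inverse_Cinfty_c => z.
  rewrite -img => -[x Ux <-]; rewrite pinvKV ?mem_set//.
  by case: Ux => -[].
Qed.

End local_inverse.

(** * The inverse function theorem *)

(** Applying [M] to the inclusion that defines tameness. *)
Lemma tame_near_identity (R : realType) (E : tvsType R)
    (f : partial_map E E) (x0 : E) (BB : set (set E)) (M : E -> E) (B : set E)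
    (v b : E) :
  Colo_A (prestrict f setT) x0 2^-1 BB -> linear M -> cancel (dderiv f x0) M ->
  absolutely_convex B -> BB B -> B v -> B b ->
  dilate 2^-1 B (b - M (dderiv f (x0 + 2 *: v) b)).
Proof.
move=> [_ _ _ _ tame] linM LK cB BBB Bv Bb.
have [_ _ sub] := tame B v BBB Bv.
have [_ [b' Bb' <-] e] := sub _ (ex_intro2 _ _ b Bb erefl).
rewrite -opprB -{2}(LK b) -(linear_at_sub linM).
rewrite -[X in M X]e (linear_at_scale linM) LK.
by apply: dilateN => //; exists b'.
Qed.

Theorem corollary9 (R : realType) (E : tvsType R) (f : partial_map E E) (x0 : E) :
  hausdorff_space E ->
  cm_convenient E ->
  Cinfty_c f ->
  colombeau0_tame f x0 ->
  exists U : set E,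
    [/\ open U, U x0, pinjective (prestrict f U) &
        Cinfty_c (pinverse (prestrict f U))].
Proof.
move=> hE cmE Cf /(_ setT openT I) [BB [colo [linL _ [M [LK KL contM]]]]].
change (linear (dderiv f x0)) in linL.
change (cancel (dderiv f x0) M) in LK; change (cancel M (dderiv f x0)) in KL.
have linM : linear M.
  by move=> a u w; apply: (can_inj LK); rewrite linL !KL.
have [_ _ _ genBB tame] := colo.
apply: (@local_inverse R E f x0 BB M) => // B v BBB Bv.
split; first by have [[]] := tame B v BBB Bv.
move=> b Bb; apply: (tame_near_identity colo) => //.
by case: genBB => /(_ B BBB) [].
Qed.
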